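(* Let $(\Omega,V)$ be a Cartan pair with $V$ connected, let $a\in V$, and assume that there is an isometric linear extension operator $E:\mathscr{S}_a(V)\to\mathscr{S}_a(\Omega)$. Then $(\Omega,V)$ is a complete np pair.
   Context: A Cartan pair is a pair $(\Omega,V)$ where $\Omega$ is a connected pseudoconvex (open) set in $\mathbb{C}^n$ and $V$ is an analytic subvariety of $\Omega$. For a Hilbert space $\mathcal{H}$, $B(\mathcal{H})$ denotes the bounded linear operators on $\mathcal{H}$ with the operator norm. A holomorphic function on $V$ (scalar- or $B(\mathcal{H})$-valued) is a function that locally agrees with the restriction to $V$ of a holomorphic function defined on an open set in $\mathbb{C}^n$. For a bounded function $f$ on a set $X$, $\|f\|_X=\sup_{x\in X}\|f(x)\|$. For $X=V$ or $X=\Omega$ and $a\in V$, $\mathscr{S}_a(X)$ is the set of holomorphic functions $f:X\to\overline{\mathbb{D}}$ (values in the closed unit disk) with $f(a)=0$; it is the closed unit ball of the space of bounded holomorphic functions on $X$ vanishing at $a$. An isometric linear extension operator $E:\mathscr{S}_a(V)\to\mathscr{S}_a(\Omega)$ means (the restriction to unit balls of) a linear map $E$ from the bounded holomorphic functions on $V$ vanishing at $a$ to the bounded holomorphic functions on $\Omega$ vanishing at $a$ such that $E(f)|_V=f$ and $\|E(f)\|_\Omega=\|f\|_V$ for all $f$. $(\Omega,V)$ is a complete np pair if for every separable Hilbert space $\mathcal{H}$ and every bounded holomorphic function $f:V\to B(\mathcal{H})$ there is a bounded holomorphic function $F:\Omega\to B(\mathcal{H})$ with $F|_V=f$ and $\|F\|_\Omega=\|f\|_V$.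 *)

(* Defs.v *)
From HB Require Import structures.
From mathcomp Require Import all_boot all_order all_algebra.
From mathcomp Require Import all_classical all_reals all_analysis.
From mathcomp Require Import sesquilinear complex.

Set Implicit Arguments.
Unset Strict Implicit.
Unset Printing Implicit Defensive.

Import Order.TTheory GRing.Theory Num.Theory.
Import numFieldNormedType.Exports.

Local Open Scope classical_set_scope.
Local Open Scope ring_scope.

(* The complex numbers over [R].  Naming the structure, instead of using the   *)
(* type [R[i]] directly, lets them inherit the topology and the norm that      *)
(* every [numClosedFieldType] carries.                                         *)
Definition CC (R : realType) : numClosedFieldType := R[i].

Section Norms.
Variable R : realType.
Local Notation C := (CC R).

(* Norms of [normedModType C] take their values in [C]; [rnorm] is the same    *)
(* norm seen as a real number.                                                 *)
Definition rnorm (W : normedModType C) (x : W) : R := complex.Re `|x|.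

Lemma rnormE (W : normedModType C) (x : W) : (rnorm x)%:C%C = `|x| :> C.
Proof.
have : (0 : C) <= `|x| by exact: normr_ge0.
rewrite /rnorm; case: (`|x|) => a b.
by rewrite lecE /= => /andP[/eqP -> _].
Qed.

Definition sup_norm (T : Type) (W : normedModType C) (X : set T) (f : T -> W) : R :=
  sup [set rnorm (f z) | z in X].

End Norms.

Section BoundedOperators.
Variables (R : realType) (H : normedModType (CC R)).
Local Notation C := (CC R).

(* [B(H)] is the type [bop H] below, normed by the operator norm [opnorm].     *)
Definition bounded_op : {pred H -> H} := mem [set T : H -> H |
  linear T /\ exists M : R, forall x, rnorm (T x) <= M * rnorm x].

Lemma rnorm_ge0 (x : H) : 0 <= rnorm x.
Proof. by rewrite -lecR rnormE normr_ge0. Qed.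

Lemma rnormD (x y : H) : rnorm (x + y) <= rnorm x + rnorm y.
Proof. by rewrite -lecR rmorphD /= !rnormE ler_normD. Qed.

Lemma rnormZ (a : C) (x : H) : rnorm (a *: x) = rnorm (a : C) * rnorm x.
Proof. by apply: (@complexI R); rewrite rmorphM /= !rnormE normrZ. Qed.

Lemma rnorm_eq0 (x : H) : rnorm x = 0 -> x = 0.
Proof. by move=> x0; apply/normr0_eq0; rewrite -rnormE x0. Qed.

Lemma rnorm0 : rnorm (0 : H) = 0.
Proof. by rewrite /rnorm normr0. Qed.

Fact bounded_op_submod : submod_closed bounded_op.
Proof.
split.
  rewrite inE; split; first by move=> a x y; rewrite /= scaler0 addr0.
  by exists 0 => x; rewrite rnorm0 mul0r.
move=> a S T; rewrite !inE => -[lS [M bS]] [lT [N bT]]; split.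
  move=> b x y; rewrite !fctE lS lT !scalerDr !scalerA mulrC.
  by rewrite addrACA.
exists (rnorm (a : C) * M + N) => x.
rewrite mulrDl -mulrA; apply: le_trans (rnormD _ _) _.
rewrite lerD// rnormZ ler_wpM2l//.
by rewrite -lecR rnormE normr_ge0.
Qed.

HB.instance Definition _ :=
  GRing.isSubmodClosed.Build C (H -> H) bounded_op bounded_op_submod.

Record bop : Type := Bop { bop_fun :> H -> H; _ : bop_fun \in bounded_op }.

HB.instance Definition _ := [isSub of bop for bop_fun].
HB.instance Definition _ := [Choice of bop by <:].
HB.instance Definition _ := [SubChoice_isSubLmodule of bop by <:].

Definition opnorm (T : bop) : R := sup [set rnorm (T x) | x in [set x | rnorm x <= 1]].

Lemma bopP (T : bop) :
  linear T /\ exists M : R, forall x, rnorm (T x) <= M * rnorm x.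
Proof. by case: T => T /=; rewrite inE. Qed.

Lemma opnorm_has_sup (T : bop) :
  has_sup [set rnorm (T x) | x in [set x | rnorm x <= 1]].
Proof.
split; first by exists (rnorm (T 0)), 0 => //=; rewrite rnorm0.
have [_ [M bT]] := bopP T; exists `|M| => _ [x /= x1 <-].
apply: le_trans (bT x) _; apply: le_trans (ler_norm _) _.
by rewrite normrM ler_piMr// ger0_norm// rnorm_ge0.
Qed.

Lemma opnorm_ub (T : bop) x : rnorm x <= 1 -> rnorm (T x) <= opnorm T.
Proof.
by move=> x1; apply: sup_upper_bound (opnorm_has_sup T) _ _; exists x.
Qed.

Lemma opnorm_le (T : bop) (M : R) :
  (forall x, rnorm x <= 1 -> rnorm (T x) <= M) -> opnorm T <= M.
Proof.
move=> TM; apply: ge_sup; first by case: (opnorm_has_sup T).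
by move=> _ [x /= x1 <-]; exact: TM.
Qed.

Let norm (T : bop) : C := (opnorm T)%:C%C.

Lemma opnorm_ge0 (T : bop) : 0 <= opnorm T.
Proof.
by apply: le_trans (rnorm_ge0 (T 0)) (opnorm_ub _ _); rewrite rnorm0.
Qed.

Fact bop_normD (S T : bop) : norm (S + T) <= norm S + norm T.
Proof.
rewrite /norm -rmorphD lecR; apply: opnorm_le => x x1.
by apply: le_trans (rnormD _ _) _; rewrite lerD// opnorm_ub.
Qed.

Fact bop_normZ (a : C) (T : bop) : norm (a *: T) = `|a| * norm T.
Proof.
have le b (S : bop) : opnorm (b *: S) <= rnorm (b : C) * opnorm S.
  apply: opnorm_le => x x1.
  have -> : rnorm ((b *: S : bop) x) = rnorm (b : C) * rnorm (S x).
    by rewrite -rnormZ.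
  by rewrite ler_wpM2l ?opnorm_ub// -lecR rnormE normr_ge0.
rewrite -[`|a|]rnormE /norm -rmorphM; congr (_%:C)%C.
have [->|a0] := eqVneq a 0.
  apply/eqP; rewrite eq_le le/= /rnorm normr0 mul0r; exact: opnorm_ge0.
apply/eqP; rewrite eq_le le/=.
have := le a^-1 (a *: T); rewrite scalerA mulVf// scale1r => leT.
have pa : 0 < rnorm (a : C) by rewrite -ltcR rnormE normr_gt0.
rewrite -ler_pdivlMl//; apply: le_trans leT _.
suff -> : rnorm (a^-1 : C) = (rnorm (a : C))^-1 by [].
by apply: (@complexI R); rewrite fmorphV/= !rnormE normfV.
Qed.

Fact bop_norm_eq0 (T : bop) : norm T = 0 -> T = 0.
Proof.
move=> /complexI T0; apply/val_inj/funext => x /=; apply: rnorm_eq0.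
have [[lT _] [->|x0]] := (bopP T, eqVneq x 0).
  by have := lT (-1) 0 0; rewrite scaler0 addr0 scaleN1r addNr => ->; rewrite rnorm0.
have px : 0 < rnorm x by rewrite -ltcR rnormE normr_gt0.
pose c : C := (rnorm x)^-1%:C%C.
have nc : rnorm c = (rnorm x)^-1.
  apply: (@complexI R); rewrite rnormE ger0_norm//.
  by rewrite lecR invr_ge0 ltW.
have: rnorm (T (c *: x)) <= 0.
  by rewrite -T0 opnorm_ub// rnormZ nc mulVf ?gt_eqF.
have -> : T (c *: x) = c *: T x.
  have T00 : T 0 = 0.
    by have := lT (-1) 0 0; rewrite scaler0 addr0 scaleN1r addNr.
  by have := lT c x 0; rewrite !addr0 T00 addr0.
rewrite rnormZ nc pmulr_rle0 ?invr_gt0// => Tx.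
by apply/eqP; rewrite eq_le Tx rnorm_ge0.
Qed.

HB.instance Definition _ :=
  Lmodule_isNormed.Build C bop bop_normD bop_normZ bop_norm_eq0.

Lemma bop_normE (T : bop) : `|T| = (opnorm T)%:C%C :> C.
Proof. by []. Qed.

Lemma rnorm_bop (T : bop) : rnorm T = opnorm T.
Proof. by apply: (@complexI R); rewrite rnormE. Qed.

End BoundedOperators.

(* [hilbert_space H]: the norm of the Banach space [H] comes from an inner     *)
(* product, linear in its first argument.                                      *)
Definition hilbert_space (R : realType) (H : completeNormedModType (CC R)) : Prop :=
  exists dot : {dot H for Num.conj}, forall x : H, dot x x = `|x| ^+ 2.

Definition separable_space (T : topologicalType) : Prop :=
  exists2 D : set T, countable D & dense D.

Fact near_eq_differentiable (K : numFieldType) (V W : normedModType K)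
    (f g : V -> W) (x : V) :
  (\forall y \near x, f y = g y) -> differentiable f x -> differentiable g x.
Proof.
move=> fg df; have [cdf /eqaddoP fo] := (diff_locallyP x f).1 df.
have go : g \o shift x = cst (g x) + 'd f x +o_ (0 : V) id.
  apply/eqaddoP => e e0.
  have fg0 : \forall h \near (0 : V), f (h + x) = g (h + x).
    by move: fg; rewrite (near_shift 0) /= subr0.
  near=> h.
  have fgh : f (h + x) = g (h + x) by near: h.
  have -> : (g \o shift x - (cst (g x) + 'd f x)) h =
      (f \o shift x - (cst (f x) + 'd f x)) h.
    by rewrite !fctE /= fgh (nbhs_singleton fg).
  by near: h; exact: fo.
apply/diff_locallyP; rewrite (diff_unique cdf go); split=> //.
Unshelve. all: by end_near. Qed.

Section SeveralComplexVariables.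
Variables (R : realType) (n : nat).
Local Notation C := (CC R).
Local Notation Cn := 'rV[CC R]_n.
Implicit Types (Omega V X U : set Cn) (a z w : Cn).

Definition expi (t : R) : C := (cos t +i* sin t)%C.

(* For a continuous real-valued [phi], plurisubharmonicity reduces to the      *)
(* sub-mean value inequality on the closed discs of complex lines.             *)
Definition continuous_psh Omega (phi : Cn -> R) : Prop :=
  {within Omega, continuous phi} /\
  forall z w, (forall c : C, `|c| <= 1 -> Omega (z + c *: w)) ->
    phi z <= (2 * pi)^-1 *
      \int[lebesgue_measure]_(t in `[0, 2 * pi]) phi (z + expi t *: w).

Definition pseudoconvex Omega : Prop :=
  open Omega /\ exists phi : Cn -> R, continuous_psh Omega phi /\
    forall c : R, compact (Omega `&` [set z | phi z <= c]).

Definition holomorphic_open (W : normedModType C) U (f : Cn -> W) : Prop :=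
  forall z, U z -> differentiable f z.

(* [f] is locally the restriction of a holomorphic function.  Functions on [X] *)
(* are represented by total functions, whose values outside [X] are ignored.   *)
Definition holomorphic_on (W : normedModType C) X (f : Cn -> W) : Prop :=
  forall z, X z -> exists (U : set Cn) (F : Cn -> W),
    [/\ open U, U z, holomorphic_open U F & {in X `&` U, F =1 f}].

Lemma holomorphic_onE (W : normedModType C) X (f : Cn -> W) :
  open X -> holomorphic_on X f <-> holomorphic_open X f.
Proof.
move=> oX; split=> [hf z Xz|hf z Xz]; last by exists X, f.
have [U [F [oU Uz dF Ff]]] := hf z Xz.
apply: near_eq_differentiable (dF z Uz).
have : \forall y \near z, (X `&` U) y by apply: open_nbhs_nbhs; split=> //; exact: openI.
by apply: filterS => y XUy; apply: Ff; rewrite inE.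
Qed.

Definition analytic_subvariety Omega V : Prop :=
  V `<=` Omega /\ forall z, Omega z -> exists (U : set Cn) (k : nat) (g : 'I_k -> Cn -> C),
    [/\ open U, U z, U `<=` Omega, forall i, holomorphic_open U (g i)
      & V `&` U = [set w | U w /\ forall i, g i w = 0]].

Definition cartan_pair Omega V : Prop :=
  [/\ connected Omega, pseudoconvex Omega & analytic_subvariety Omega V].

Definition Hinfty (W : normedModType C) X (f : Cn -> W) : Prop :=
  holomorphic_on X f /\ [bounded f z | z in X].

Definition Hinfty_at a X (f : Cn -> C) : Prop := Hinfty X f /\ f a = 0.

(* [E] acts on functions on [V]: its value on [f] depends only on [f] on [V].  *)
Definition isometric_linear_extension a Omega V (E : (Cn -> C) -> (Cn -> C)) : Prop :=
  [/\ forall f, Hinfty_at a V f -> Hinfty_at a Omega (E f),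
      forall f g, Hinfty_at a V f -> Hinfty_at a V g ->
        {in V, f =1 g} -> {in Omega, E f =1 E g},
      forall (c : C) f g, Hinfty_at a V f -> Hinfty_at a V g ->
        {in Omega, E (c *: f + g) =1 c *: E f + E g},
      forall f, Hinfty_at a V f -> {in V, E f =1 f}
    & forall f, Hinfty_at a V f -> sup_norm Omega (E f) = sup_norm V f].

Definition complete_np_pair Omega V : Prop :=
  forall H : completeNormedModType C, hilbert_space H -> separable_space H ->
  forall f : Cn -> bop H, Hinfty V f ->
  exists F : Cn -> bop H,
    [/\ Hinfty Omega F, {in V, F =1 f} & sup_norm Omega F = sup_norm V f].

End SeveralComplexVariables.

(* Main.v *)
(* A linear functional of norm at most 1 is automatically completely           *)
(* contractive: if [f] vanishes at [a], the operator [F z] defined by          *)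
(* <F z x, y> = E (<f x, y>) z has norm at most sup |f|.  A general [f] with   *)
(* values in a ball of radius r < 1 is first moved to the case f a = 0 by the  *)
(* operator Moebius transform centred at f a, and the extension is moved back; *)
(* r = 1 is reached by a weak limit along an ultrafilter.  Holomorphy of [F]   *)
(* follows from Cauchy estimates for the scalar functions <F x, y>, in the     *)
(* form of a bound on second differences that is uniform in x and y and passes *)
(* to weak limits.  Since holomorphic means only differentiable at each point, *)
(* the estimates are derived from Goursat's theorem.                           *)
From HB Require Import structures.
Require Import Defs.
From mathcomp Require Import all_boot all_order all_algebra.
From mathcomp Require Import all_classical all_reals all_analysis.
From mathcomp Require Import sesquilinear complex.
From mathcomp Require Import ring lra.
Import Order.TTheory GRing.Theory Num.Theory.
Import numFieldNormedType.Exports.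

Set Implicit Arguments.
Unset Strict Implicit.
Unset Printing Implicit Defensive.

Local Open Scope classical_set_scope.
Local Open Scope ring_scope.

(** * Real-valued norms and differentiability *)

(** An operator norm is a supremum of scalar coefficients, so a scalar extension operator of norm 1
    acts on operator-valued functions without loss. Only functions vanishing at [a] may be fed to
    [E], so the value [A = f a] has to be removed first. For |f| <= r < 1 put K = (f - A)(1 - As
    f)^-1, P = (1 - A As)^-1 and Q = (1 - As A)^-1, where [As] is the adjoint of [A]. By
    [defect_identity], |f z| <= 1 corresponds to <P K x, K x> <= <Q x, x>, and Cauchy-Schwarz for
    the form of P turns this into |<P K x, y>|^2 <= <Q x, x> <P y, y>. Since [E] is isometric, the
    functions E(<P K x, y>) satisfy the same inequality on all of [Omega]; they are the coefficients
    <P G x, y> of an operator G, and the choice y = G x gives back <P G x, G x> <= <Q x, x>. The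
    inverse transform ([moebius_inverse]) yields the extension F; this is [contraction_extension].
    Scaling gives every bound above sup |f|, and a weak limit gives sup |f| itself
    ([isometric_extension]).

    Holomorphy has to be recovered from coefficients. A bound on second differences that mentions no
    derivative ([second_difference_ball]) is uniform over unit vectors x and y, so it holds in
    operator norm ([weak_second_difference]) and survives weak limits; [second_difference_has_diff]
    then builds the derivative as a weak limit of difference quotients. Differentiability crosses
    the Moebius transforms by an exact difference formula ([moebius_diff], [has_diff_transfer]).

    The scalar estimate rests on [goursat]: the difference of two difference quotients of one
    function has boundary integral 0, which bounds an increment of the function from above
    ([lipschitz_clamped]). Used twice, this first-order estimate gives the second-order one. *)

Section RealNorm.
Variables (R : realType) (W : normedModType (CC R)).
Local Notation C := (CC R).
Implicit Types (x y : W).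

Lemma rnormN x : rnorm (- x) = rnorm x.
Proof. by rewrite /rnorm normrN. Qed.

Lemma rnorm_distC x y : rnorm (x - y) = rnorm (y - x).
Proof. by rewrite /rnorm distrC. Qed.

Lemma rnormB x y : rnorm (x - y) <= rnorm x + rnorm y.
Proof. by rewrite -(rnormN y) rnormD. Qed.

Lemma rnorm_triangle x y z : rnorm (x - z) <= rnorm (x - y) + rnorm (y - z).
Proof. by apply: le_trans (rnormD _ _); rewrite addrA subrK. Qed.

Lemma rnorm_sum (I : Type) (r : seq I) (P : pred I) (f : I -> W) :
  rnorm (\sum_(i <- r | P i) f i) <= \sum_(i <- r | P i) rnorm (f i).
Proof.
elim/big_ind2: _ => [|x1 x2 y1 y2 h1 h2|//]; first by rewrite rnorm0.
by apply: le_trans (rnormD _ _) _; exact: lerD.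
Qed.

Lemma rnorm_gt0 x : (0 < rnorm x) = (x != 0).
Proof.
rewrite lt_neqAle rnorm_ge0 andbT eq_sym; congr (~~ _).
by apply/eqP/eqP => [/rnorm_eq0//|->]; exact: rnorm0.
Qed.

Lemma rnorm_le_small x : (forall e : R, 0 < e -> rnorm x <= e) -> x = 0.
Proof.
move=> h; apply: rnorm_eq0; apply/eqP; rewrite eq_le rnorm_ge0 andbT.
apply/ler_addgt0Pl => e e0; rewrite addr0; exact: h.
Qed.

Lemma near_rnormP x (P : W -> Prop) :
  (\forall y \near x, P y) <->
  exists2 d : R, 0 < d & forall y, rnorm (y - x) < d -> P y.
Proof.
split=> [/nbhs_normP[d /= d0 h]|[d d0 h]].
- exists (complex.Re d); first by move: d0; rewrite ltcE => /andP[].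
  move=> y yd; apply: h => /=; rewrite distrC -rnormE.
  by move: d0; rewrite !ltcE /= => /andP[/eqP -> _]; rewrite eqxx.
- apply/nbhs_normP; exists (d%:C%C) => /=; first by rewrite ltcR.
  by move=> y /=; rewrite distrC -rnormE ltcR => /h.
Qed.

Lemma open_rnormP (U : set W) :
  open U <-> forall x, U x ->
    exists2 d : R, 0 < d & forall y, rnorm (y - x) < d -> U y.
Proof.
rewrite openE; split=> h x Ux.
- by apply/near_rnormP; exact: h.
- by apply/near_rnormP; exact: h.
Qed.

Lemma bounded_rnormP (T : Type) (X : set T) (f : T -> W) :
  [bounded f z | z in X] <-> exists M : R, forall z, X z -> rnorm (f z) <= M.
Proof.
split=> [[M [Mr h]]|[M h]].
- exists (complex.Re M + 1) => z Xz; rewrite -lecR rnormE.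
  have := h (M + 1); rewrite ltrDl ltr01 => /(_ isT z Xz) /=.
  move: Mr => /complex_realP[k ->]; rewrite /=.
  by rewrite rmorphD rmorph1.
- exists (M%:C%C); split; first by apply/complex_realP; exists M.
  move=> N MN z Xz /=; apply: le_trans (ltW MN).
  by rewrite -rnormE lecR; exact: h.
Qed.

Lemma sup_norm_ub (T : Type) (X : set T) (f : T -> W) (M : R) z :
  (forall z, X z -> rnorm (f z) <= M) -> X z -> rnorm (f z) <= sup_norm X f.
Proof.
move=> h Xz; apply: ub_le_sup; last by exists z.
by exists M => _ [w Xw <-]; exact: h.
Qed.

Lemma sup_norm_le (T : Type) (X : set T) (f : T -> W) (M : R) z :
  X z -> (forall z, X z -> rnorm (f z) <= M) -> sup_norm X f <= M.
Proof.
move=> Xz h; apply: ge_sup; first by exists (rnorm (f z)), z.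
by move=> _ [w Xw <-]; exact: h.
Qed.

End RealNorm.

Section ComplexModulus.
Variable R : realType.
Local Notation C := (CC R).
Implicit Types (z w : C).

Lemma rnormM z w : rnorm (z * w) = rnorm z * rnorm w.
Proof. by rewrite -[z * w]/(z *: w) rnormZ. Qed.

Lemma rnormV z : rnorm (z^-1 : C) = (rnorm z)^-1.
Proof. by apply: (@complexI R); rewrite fmorphV/= !rnormE normfV. Qed.

Lemma rnormR (x : R) : rnorm (x%:C%C : C) = `|x|.
Proof. by rewrite /rnorm normc_def /= expr0n /= addr0 sqrtr_sqr. Qed.

Lemma rnorm_nat (k : nat) : rnorm (k%:R : C) = k%:R.
Proof. by rewrite /rnorm normr_nat -(rmorph_nat (real_complex R)). Qed.

Lemma rnorm_i : rnorm ('i%C : C) = 1.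
Proof. by rewrite /rnorm normc_def /= expr0n /= add0r expr1n sqrtr1. Qed.

Lemma rnorm_sqr z : rnorm z ^+ 2 = complex.Re z ^+ 2 + complex.Im z ^+ 2.
Proof. by rewrite /rnorm normc_def /= sqr_sqrtr// addr_ge0 ?sqr_ge0. Qed.

Lemma rnorm_conj z : rnorm (z^* : C) = rnorm z.
Proof. by rewrite /rnorm norm_conjC. Qed.

Lemma Re_le_rnorm z : `|complex.Re z| <= rnorm z.
Proof.
rewrite -(@ler_pXn2r _ 2)// ?nnegrE ?rnorm_ge0// rnorm_sqr real_normK ?num_real//.
by rewrite lerDl sqr_ge0.
Qed.

Lemma Im_le_rnorm z : `|complex.Im z| <= rnorm z.
Proof.
rewrite -(@ler_pXn2r _ 2)// ?nnegrE ?rnorm_ge0// rnorm_sqr real_normK ?num_real//.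
by rewrite lerDr sqr_ge0.
Qed.

Lemma rnorm_le_ReIm z : rnorm z <= `|complex.Re z| + `|complex.Im z|.
Proof.
rewrite -(@ler_pXn2r _ 2)// ?nnegrE ?rnorm_ge0 ?addr_ge0// rnorm_sqr.
rewrite sqrrD !real_normK ?num_real// -addrA lerD2l lerDr.
by rewrite mulrn_wge0 ?mulr_ge0.
Qed.

Lemma ReB z w : complex.Re (z - w) = complex.Re z - complex.Re w.
Proof. by rewrite raddfB. Qed.

Lemma ImB z w : complex.Im (z - w) = complex.Im z - complex.Im w.
Proof. by rewrite raddfB. Qed.

Lemma ReM z w : complex.Re (z * w) =
  complex.Re z * complex.Re w - complex.Im z * complex.Im w.
Proof. by case: z; case: w. Qed.

Lemma ImM z w : complex.Im (z * w) =
  complex.Re z * complex.Im w + complex.Im z * complex.Re w.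
Proof. by case: z; case: w. Qed.

End ComplexModulus.

(* Frechet differentiability with real-valued norms: the norms of the library  *)
(* take their values in [CC R].                                                *)
Definition has_diff (R : realType) (V W : normedModType (CC R))
    (f : V -> W) (z : V) (D : V -> W) : Prop :=
  [/\ linear D, exists m : R, forall h, rnorm (D h) <= m * rnorm h &
    forall e : R, 0 < e -> exists2 d : R, 0 < d & forall h, rnorm h < d ->
      rnorm (f (z + h) - f z - D h) <= e * rnorm h].

Section Differentiability.
Variables (R : realType).
Local Notation C := (CC R).

Lemma differentiable_has_diff (V W : normedModType C) (f : V -> W) z :
  differentiable f z <-> exists D, has_diff f z D.
Proof.
split=> [df|[D [lD [m bD] oD]]].
- have [cdf /eqaddoP fo] := (diff_locallyP z f).1 df.
  exists ('d f z); split.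
  + exact: linearP.
  + have /linear_boundedP[M [Mr h]] :
      bounded_near ('d f z) (nbhs (0 : V)) by exact: continuous_linear_bounded.
    move: Mr => /complex_realP[k kM]; exists (k + 1) => x.
    have := h (M + 1); rewrite ltrDl ltr01 => /(_ isT x).
    by rewrite -lecR rmorphM /= !rnormE kM rmorphD rmorph1.
  + move=> e e0; have e0' : (0 : C) < e%:C%C by rewrite ltcR.
    have /near_rnormP[d d0 hd] := fo _ e0'.
    exists d => // h; have := hd h; rewrite subr0 => /[apply].
    rewrite -lecR rmorphM /= !rnormE /=; congr (_ <= _).
    by rewrite !fctE /= opprD addrA (addrC h).
- pose DL := GRing.isLinear.Build _ _ _ _ _ lD.
  pose Dl : {linear V -> W} := HB.pack D DL.
  have cD : continuous Dl.
    apply: bounded_linear_continuous.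
    apply/linear_boundedP; exists (m%:C%C); split; first by apply/complex_realP; exists m.
    move=> r mr x; apply: le_trans (ler_wpM2r _ (ltW mr)); last exact: normr_ge0.
    by rewrite -!rnormE -rmorphM /= lecR; exact: bD.
  have o : f \o shift z = cst (f z) + Dl +o_ (0 : V) id.
    apply/eqaddoP => e; rewrite ltcE /= => /andP[/eqP ei e0].
    have [d d0 hd] := oD _ e0.
    apply/near_rnormP; exists d => // h; rewrite subr0 => /hd.
    have -> : e = (complex.Re e)%:C%C by move: ei; case: (e) => a b /= ->.
    rewrite -lecR rmorphM /= !rnormE /=; congr (_ <= _).
    by rewrite !fctE /= opprD addrA (addrC h).
  by apply/diff_locallyP; rewrite (diff_unique cD o).
Qed.

End Differentiability.

(** * Integrals of complex functions on segments *)

Section SegmentIntegral.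
Variable R : realType.
Local Notation C := (CC R).
Implicit Types (a b c : R).

Definition rint a b (f : R -> R) : R :=
  (\int[lebesgue_measure]_(x in `[a, b]) f x)%R.

Lemma continuous_itv_integrable a b (f : R -> R) : continuous f ->
  (@lebesgue_measure R).-integrable `[a, b] (EFin \o f).
Proof.
move=> cf; apply: continuous_compact_integrable; first exact: segment_compact.
exact: continuous_subspaceT.
Qed.

Lemma rint_cst a b c : a <= b -> rint a b (fun=> c) = c * (b - a).
Proof.
move=> ab; rewrite /rint Rintegral_cst//=.
rewrite lebesgue_measure_itv /= lte_fin.
by move: ab; rewrite le_eqVlt => /orP[/eqP ->|->]; rewrite ?ltxx ?subrr ?mulr0.
Qed.

Lemma rint_le a b (f g : R -> R) : continuous f -> continuous g ->
  (forall x, a <= x <= b -> f x <= g x) -> rint a b f <= rint a b g.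
Proof.
move=> cf cg fg; apply: le_Rintegral => //; try exact: continuous_itv_integrable.
Qed.

Lemma rintD a b (f g : R -> R) : continuous f -> continuous g ->
  rint a b (fun x => f x + g x) = rint a b f + rint a b g.
Proof.
move=> cf cg; apply: RintegralD => //; exact: continuous_itv_integrable.
Qed.

Lemma rint_chasles a b c (f : R -> R) : continuous f -> a <= c -> c <= b ->
  rint a b f = rint a c f + rint c b f.
Proof.
move=> cf ac cb.
have itf := @continuous_itv_integrable a b f cf.
have := Rintegral_itvB itf (_ : BLeft a <= BRight c)%O (_ : BRight c <= BRight b)%O.
rewrite !bnd_simp => /(_ ac cb) /eqP; rewrite subr_eq => /eqP; rewrite /rint => ->.
rewrite addrC; congr (_ + _).
apply: Rintegral_itv_obnd_cbnd.
apply: integrableS (@continuous_itv_integrable c b f cf) => //.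
exact: subset_itv_oc_cc.
Qed.

(** Built from the real integrals of the two components; global continuity ([ccontinuous]) supplies
    integrability on every segment. *)
Definition cint a b (f : R -> C) : C :=
  (rint a b (@complex.Re R \o f) +i* rint a b (@complex.Im R \o f))%C.

Definition ccontinuous (f : R -> C) : Prop :=
  continuous (@complex.Re R \o f) /\ continuous (@complex.Im R \o f).

Lemma cintD a b (f g : R -> C) : ccontinuous f -> ccontinuous g ->
  cint a b (fun x => f x + g x) = cint a b f + cint a b g.
Proof.
move=> [cf1 cf2] [cg1 cg2]; rewrite /cint -[RHS]/(complex.Complex _ _) -!rintD//.
by congr complex.Complex; congr rint; apply/funext => x /=; rewrite raddfD.
Qed.

Lemma cint_chasles a b c (f : R -> C) : ccontinuous f -> a <= c -> c <= b ->
  cint a b f = cint a c f + cint c b f.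
Proof.
move=> [cf1 cf2] ac cb; rewrite /cint -[RHS]/(complex.Complex _ _).
by rewrite (rint_chasles cf1 ac cb) (rint_chasles cf2 ac cb).
Qed.

(** The two components are estimated separately, which costs the factor 2. *)
Lemma cint_near a b (f : R -> C) (c : C) (B : R) : ccontinuous f -> a <= b ->
  (forall x, a <= x <= b -> rnorm (f x - c) <= B) ->
  rnorm (cint a b f - c * (b - a)%:C%C) <= 2 * B * (b - a).
Proof.
move=> [cf1 cf2] ab fc; have ab0 : 0 <= b - a by rewrite subr_ge0.
have key (p : R -> R) (q : R) : continuous p ->
    (forall x, a <= x <= b -> `|p x - q| <= B) ->
    `|rint a b p - q * (b - a)| <= B * (b - a).
  move=> cp pq.
  have ccst (k : R) : continuous (fun _ : R => k) by move=> ?; exact: cst_continuous.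
  have h1 : rint a b p <= rint a b (fun=> q + B).
    by apply: rint_le => // x /pq; rewrite ler_norml; lra.
  have h2 : rint a b (fun=> q - B) <= rint a b p.
    by apply: rint_le => // x /pq; rewrite ler_norml; lra.
  by move: h1 h2; rewrite !rint_cst// ler_norml; lra.
apply: le_trans (rnorm_le_ReIm _) _.
rewrite ReB ImB ReM ImM /= !mulr0 subr0 add0r -mulrA mulr_natl mulr2n; apply: lerD.
- apply: key => // x /fc; apply: le_trans; rewrite /= -ReB; exact: Re_le_rnorm.
- apply: key => // x /fc; apply: le_trans; rewrite /= -ImB; exact: Im_le_rnorm.
Qed.

Lemma continuous_to_real (W : normedModType C) (f : W -> R) :
  (forall z (e : R), 0 < e ->
    exists2 d : R, 0 < d & forall y, rnorm (y - z) < d -> `|f y - f z| < e) ->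
  continuous f.
Proof.
move=> h z; apply/cvgrPdist_lt => e e0; apply/near_rnormP.
by have [d d0 hd] := h z _ e0; exists d => // y /hd; rewrite distrC.
Qed.

Lemma continuous_Re : continuous (@complex.Re R : C -> R).
Proof.
apply: continuous_to_real => z e e0; exists e => // w; apply: le_lt_trans.
rewrite -ReB; exact: Re_le_rnorm.
Qed.

Lemma continuous_Im : continuous (@complex.Im R : C -> R).
Proof.
apply: continuous_to_real => z e e0; exists e => // w; apply: le_lt_trans.
rewrite -ImB; exact: Im_le_rnorm.
Qed.

Lemma ccontinuous_comp (f : R -> C) : continuous f -> ccontinuous f.
Proof.
move=> cf; split=> x; apply: continuous_comp; (try exact: cf).
- exact: continuous_Re.
- exact: continuous_Im.
Qed.

Lemma continuous_rnormP (V W : normedModType C) (f : V -> W) z :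
  {for z, continuous f} <-> forall e : R, 0 < e ->
    exists2 d : R, 0 < d & forall y, rnorm (y - z) < d -> rnorm (f y - f z) < e.
Proof.
split=> [/cvgrPdist_lt h e e0|h].
- have e0' : (0 : C) < e%:C%C by rewrite ltcR.
  have /near_rnormP[d d0 hd] := h _ e0'.
  exists d => // y /hd; rewrite -rnormE ltcR rnorm_distC; exact.
- apply/cvgrPdist_lt => e; rewrite ltcE /= => /andP[/eqP ei e0].
  have [d d0 hd] := h _ e0; apply/near_rnormP; exists d => // y /hd.
  have -> : e = (complex.Re e)%:C%C by move: ei; case: (e) => a b /= ->.
  by rewrite -rnormE ltcR rnorm_distC.
Qed.

Lemma continuous_from_real (V : normedModType C) (f : R -> V) :
  (forall z (e : R), 0 < e ->
    exists2 d : R, 0 < d & forall y, `|y - z| < d -> rnorm (f y - f z) < e) ->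
  continuous f.
Proof.
move=> h z; apply/cvgrPdist_lt => e; rewrite ltcE /= => /andP[/eqP ei e0].
have [d d0 hd] := h z _ e0; apply/nbhs_normP; exists d => //= y /=.
rewrite distrC => /hd.
have -> : e = (complex.Re e)%:C%C by move: ei; case: (e) => a b /= ->.
by rewrite -rnormE ltcR rnorm_distC.
Qed.

Lemma continuous_Complexl (y : R) : continuous (fun x : R => (x +i* y)%C : C).
Proof.
apply: continuous_from_real => z e e0; exists e => // w.
apply: le_lt_trans; apply: le_trans (rnorm_le_ReIm _) _.
by rewrite ReB ImB /= subrr normr0 addr0.
Qed.

Lemma continuous_Complexr (x : R) : continuous (fun y : R => (x +i* y)%C : C).
Proof.
apply: continuous_from_real => z e e0; exists e => // w.
apply: le_lt_trans; apply: le_trans (rnorm_le_ReIm _) _.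
by rewrite ReB ImB /= subrr normr0 add0r.
Qed.

End SegmentIntegral.

(** * Goursat theorem *)

Section Goursat.
Variable R : realType.
Local Notation C := (CC R).
Implicit Types (g : C -> C) (x y : R).

Lemma ccontinuousB (f1 f2 : R -> C) : ccontinuous f1 -> ccontinuous f2 ->
  ccontinuous (fun x => f1 x - f2 x).
Proof.
move=> [r1 i1] [r2 i2]; split=> t.
- have -> : @complex.Re R \o (fun x => f1 x - f2 x) =
    (@complex.Re R \o f1) \- (@complex.Re R \o f2) by apply/funext => s /=; rewrite ReB.
  by apply: continuousB; [exact: r1|exact: r2].
- have -> : @complex.Im R \o (fun x => f1 x - f2 x) =
    (@complex.Im R \o f1) \- (@complex.Im R \o f2) by apply/funext => s /=; rewrite ImB.
  by apply: continuousB; [exact: i1|exact: i2].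
Qed.

Lemma ccontinuous_hor g y : continuous g -> ccontinuous (fun x => g (x +i* y)%C).
Proof.
move=> cg; apply: ccontinuous_comp => x.
apply: (@continuous_comp _ _ _ (fun x : R => (x +i* y)%C : C) g); last exact: cg.
exact: continuous_Complexl.
Qed.

Lemma ccontinuous_ver g x : continuous g -> ccontinuous (fun y => g (x +i* y)%C).
Proof.
move=> cg; apply: ccontinuous_comp => y.
apply: (@continuous_comp _ _ _ (fun y : R => (x +i* y)%C : C) g); last exact: cg.
exact: continuous_Complexr.
Qed.

(* The integral of [g] along the positively oriented boundary, with opposite   *)
(* sides paired.                                                               *)
Definition rectint g x0 x1 y0 y1 : C :=
  cint x0 x1 (fun x => g (x +i* y0)%C - g (x +i* y1)%C) +
  'i%C * cint y0 y1 (fun y => g (x1 +i* y)%C - g (x0 +i* y)%C).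

Lemma rectint_splitx g x0 c x1 y0 y1 : continuous g -> x0 <= c -> c <= x1 ->
  rectint g x0 x1 y0 y1 = rectint g x0 c y0 y1 + rectint g c x1 y0 y1.
Proof.
move=> cg h1 h2; rewrite /rectint.
rewrite (cint_chasles (ccontinuousB (ccontinuous_hor y0 cg) (ccontinuous_hor y1 cg)) h1 h2).
rewrite addrACA -mulrDr -cintD; try by apply: ccontinuousB; exact: ccontinuous_ver.
by congr (_ + _ * cint _ _ _); apply/funext => y; rewrite [RHS]addrC addrA subrK.
Qed.

Lemma rectint_splity g x0 x1 y0 c y1 : continuous g -> y0 <= c -> c <= y1 ->
  rectint g x0 x1 y0 y1 = rectint g x0 x1 y0 c + rectint g x0 x1 c y1.
Proof.
move=> cg h1 h2; rewrite /rectint.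
rewrite (cint_chasles (ccontinuousB (ccontinuous_ver x1 cg) (ccontinuous_ver x0 cg)) h1 h2).
rewrite mulrDr addrACA -cintD; try by apply: ccontinuousB; exact: ccontinuous_hor.
by congr (cint _ _ _ + _); apply/funext => y; rewrite addrA subrK.
Qed.

Lemma rectintB g1 g2 x0 x1 y0 y1 : continuous g1 -> continuous g2 ->
  rectint g1 x0 x1 y0 y1 = rectint (g1 \- g2) x0 x1 y0 y1 + rectint g2 x0 x1 y0 y1.
Proof.
move=> c1 c2.
have c3 : continuous (g1 \- g2) by move=> z; apply: continuousB; [exact: c1|exact: c2].
rewrite /rectint addrACA -mulrDr -!cintD;
  try by apply: ccontinuousB; (exact: ccontinuous_hor || exact: ccontinuous_ver).
by congr (cint _ _ _ + _ * cint _ _ _); apply/funext => t /=; ring.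
Qed.

(** An affine function integrates to 0 around a rectangle. Between paired sides it changes by a
    constant, so [cint_near] applies with error [2 * B], and the contributions of the two constants
    cancel. *)
Lemma rectint_affine g x0 x1 y0 y1 (c d : C) (B : R) : continuous g ->
  x0 <= x1 -> y0 <= y1 ->
  (forall x y, x0 <= x <= x1 -> y0 <= y <= y1 ->
     rnorm (g (x +i* y)%C - (c + d * (x +i* y)%C)) <= B) ->
  rnorm (rectint g x0 x1 y0 y1) <= 4 * B * ((x1 - x0) + (y1 - y0)).
Proof.
move=> cg hx hy h.
have key z1 z2 u1 u2 : rnorm (g z1 - (c + d * z1)) <= B ->
    rnorm (g z2 - (c + d * z2)) <= B -> d * (z1 - z2) = u1 -> u2 = g z1 - g z2 ->
    rnorm (u2 - u1) <= 2 * B.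
  move=> b1 b2 <- ->; rewrite (_ : g z1 - g z2 - _ =
    (g z1 - (c + d * z1)) - (g z2 - (c + d * z2))); last by ring.
  by apply: le_trans (rnormB _ _) _; lra.
have h1 := @cint_near R x0 x1 (fun x => g (x +i* y0)%C - g (x +i* y1)%C)
  (d * (0 +i* (y0 - y1))%C) (2 * B)
  (ccontinuousB (ccontinuous_hor _ cg) (ccontinuous_hor _ cg)) hx.
have h2 := @cint_near R y0 y1 (fun y => g (x1 +i* y)%C - g (x0 +i* y)%C)
  (d * ((x1 - x0) +i* 0)%C) (2 * B)
  (ccontinuousB (ccontinuous_ver _ cg) (ccontinuous_ver _ cg)) hy.
rewrite /rectint; set I1 := cint _ _ _ in h1 *; set I2 := cint _ _ _ in h2 *.
have {}h1 : rnorm (I1 - d * (0 +i* (y0 - y1))%C * (x1 - x0)%:C%C) <= 2 * (2 * B) * (x1 - x0).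
  apply: h1 => x xx; apply: (key _ _ _ _ (h x y0 xx _) (h x y1 xx _)); rewrite ?lexx ?hy//.
  by congr (_ * _); rewrite -[LHS]/(complex.Complex _ _) /= subrr.
have {}h2 : rnorm (I2 - d * ((x1 - x0) +i* 0)%C * (y1 - y0)%:C%C) <= 2 * (2 * B) * (y1 - y0).
  apply: h2 => y yy; apply: (key _ _ _ _ (h x1 y _ yy) (h x0 y _ yy)); rewrite ?lexx ?hx//.
  by congr (_ * _); rewrite -[LHS]/(complex.Complex _ _) /= subrr.
have -> : I1 + 'i%C * I2 = (I1 - d * (0 +i* (y0 - y1))%C * (x1 - x0)%:C%C) +
   'i%C * (I2 - d * ((x1 - x0) +i* 0)%C * (y1 - y0)%:C%C).
  have e : (0 +i* (y0 - y1))%C * (x1 - x0)%:C%C +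
      'i%C * (((x1 - x0) +i* 0)%C * (y1 - y0)%:C%C) = 0 :> C.
    by apply/eqP; rewrite eq_complex /=; apply/andP; split; apply/eqP; ring.
  rewrite mulrBr addrACA -opprD -!mulrA (mulrCA 'i%C d) -mulrDr e.
  by rewrite mulr0 subr0.
apply: le_trans (rnormD _ _) _; rewrite rnormM rnorm_i mul1r.
by apply: le_trans (lerD h1 h2) _; lra.
Qed.

(** The intervals from [u n] to [u n + L / 2 ^+ n] are nested; the supremum of the left ends lies in
    all of them. *)
Lemma nested_halving (u : nat -> R) (L : R) : 0 <= L ->
  (forall n, u n <= u n.+1) ->
  (forall n, u n.+1 + L / 2 ^+ n.+1 <= u n + L / 2 ^+ n) ->
  exists t, forall n, u n <= t <= u n + L / 2 ^+ n.
Proof.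
move=> L0 u1 u2.
have mu m n : (m <= n)%N -> u m <= u n.
  by elim: n => [|n IH]; [rewrite leqn0 => /eqP ->|
    rewrite leq_eqVlt => /orP[/eqP ->//|/IH /le_trans]; apply].
have mv m n : (m <= n)%N -> u n + L / 2 ^+ n <= u m + L / 2 ^+ m.
  by elim: n => [|n IH]; [rewrite leqn0 => /eqP ->|
    rewrite leq_eqVlt => /orP[/eqP ->//|/IH]; exact/le_trans].
have uv m n : u m <= u n + L / 2 ^+ n.
  have [/mu mn|/ltnW /mv mn] := leqP m n.
    by apply: le_trans mn _; rewrite lerDl divr_ge0 ?exprn_ge0.
  by apply: le_trans mn; rewrite lerDl divr_ge0 ?exprn_ge0.
exists (sup (range u)) => n; apply/andP; split.
- apply: ub_le_sup; last by exists n.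
  by exists (u 0%N + L / 2 ^+ 0) => _ [k _ <-].
- by apply: ge_sup; [exists (u 0%N), 0%N|move=> _ [k _ <-]].
Qed.

Lemma half_pow_lt (L d : R) : 0 <= L -> 0 < d -> exists n, L / 2 ^+ n < d.
Proof.
move=> L0 d0; exists (Num.bound (L / d)).
rewrite ltr_pdivrMr ?exprn_gt0// mulrC -ltr_pdivrMr//.
apply: lt_trans (archi_boundP _) _; first by rewrite divr_ge0// ltW.
by rewrite -natrX ltr_nat ltn_expl.
Qed.

(** Bisection: one of the four quarters carries at least a quarter of the integral, and the chosen
    quarters shrink to a point near which [g] is almost affine. Perimeter and approximation error
    both decay like 2^-n, which compensates the factor 4^n. *)
Lemma goursat g x0 x1 y0 y1 : continuous g -> x0 <= x1 -> y0 <= y1 ->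
  (forall x y, x0 <= x <= x1 -> y0 <= y <= y1 ->
     exists D, has_diff g (x +i* y)%C D) ->
  rectint g x0 x1 y0 y1 = 0.
Proof.
move=> cg hx hy dg; set X := x1 - x0; set Y := y1 - y0.
have X0 : 0 <= X by rewrite subr_ge0.
have Y0 : 0 <= Y by rewrite subr_ge0.
have le4 (a b c d e : R) : a <= b + c + (d + e) ->
    [\/ a <= 4 * b, a <= 4 * c, a <= 4 * d | a <= 4 * e].
  move=> h; have [h1|h1] := leP a (4 * b); first by constructor 1.
  have [h2|h2] := leP a (4 * c); first by constructor 2.
  have [h3|h3] := leP a (4 * d); first by constructor 3.
  by constructor 4; lra.
pose r n (p : R * R) := rectint g p.1 (p.1 + X / 2 ^+ n) p.2 (p.2 + Y / 2 ^+ n).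
have quarter n p : exists q : R * R,
    [/\ p.1 <= q.1 /\ q.1 + X / 2 ^+ n.+1 <= p.1 + X / 2 ^+ n,
        p.2 <= q.2 /\ q.2 + Y / 2 ^+ n.+1 <= p.2 + Y / 2 ^+ n
      & rnorm (r n p) <= 4 * rnorm (r n.+1 q)].
  have e2 (L : R) : L / 2 ^+ n = L / 2 ^+ n.+1 + L / 2 ^+ n.+1.
    by rewrite exprS; field; rewrite expf_neq0.
  have pX : 0 <= X / 2 ^+ n.+1 by rewrite divr_ge0 ?exprn_ge0.
  have pY : 0 <= Y / 2 ^+ n.+1 by rewrite divr_ge0 ?exprn_ge0.
  have [u1 u2] : p.1 <= p.1 + X / 2 ^+ n.+1 /\
    p.1 + X / 2 ^+ n.+1 <= p.1 + X / 2 ^+ n by rewrite e2; lra.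
  have [v1 v2] : p.2 <= p.2 + Y / 2 ^+ n.+1 /\
    p.2 + Y / 2 ^+ n.+1 <= p.2 + Y / 2 ^+ n by rewrite e2; lra.
  have := erefl (r n p); rewrite {2}/r (rectint_splitx _ _ cg u1 u2).
  rewrite !(rectint_splity _ _ cg v1 v2) !e2 !(addrA p.1) !(addrA p.2).
  set p1 := p.1 + _; set p2 := p.2 + _ => e.
  have : rnorm (r n p) <= rnorm (r n.+1 p) + rnorm (r n.+1 (p.1, p2)) +
     (rnorm (r n.+1 (p1, p.2)) + rnorm (r n.+1 (p1, p2))).
    rewrite e; apply: le_trans (rnormD _ _) _.
    exact: (lerD (rnormD (r n.+1 p) (r n.+1 (p.1, p2)))
      (rnormD (r n.+1 (p1, p.2)) (r n.+1 (p1, p2)))).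
  move=> {}e.
  have [h|h|h|h] := le4 _ _ _ _ _ e.
  - by exists p; split=> //; split=> //; rewrite lerDl.
  - by exists (p.1, p2); split=> //; split; rewrite ?lerDl.
  - by exists (p1, p.2); split=> //; split; rewrite ?lerDl.
  - by exists (p1, p2); split=> //; split; rewrite ?lerDl.
pose step n p := sval (cid (quarter n p)).
pose s := fix s n := if n is k.+1 then step k (s k) else (x0, y0).
have sP n := svalP (cid (quarter n (s n))).
rewrite -/(s 0%N) in sP.
have [t ht] : exists t, forall n, (s n).1 <= t <= (s n).1 + X / 2 ^+ n.
  by apply: nested_halving => // n; have [[]] := sP n.
have [v hv] : exists t, forall n, (s n).2 <= t <= (s n).2 + Y / 2 ^+ n.
  by apply: nested_halving => // n; have [_ []] := sP n.
have rs n : rnorm (rectint g x0 x1 y0 y1) <= 4 ^+ n * rnorm (r n (s n)).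
  elim: n => [|n IH].
    by rewrite expr0 mul1r /r /= !expr0 !divr1 /X /Y !subrKC lexx.
  apply: le_trans IH _; rewrite exprSr -mulrA ler_wpM2l ?exprn_ge0//.
  by have [] := sP n.
have [D [lD _ oD]] : exists D, has_diff g (t +i* v)%C D.
  apply: dg.
    by have := ht 0%N; rewrite /= expr0 divr1 /X subrKC.
  by have := hv 0%N; rewrite /= expr0 divr1 /Y subrKC.
have DE h : D h = D 1 * h.
  have := lD h 1 0; have := lD 1 0 0; rewrite !scale1r !addr0 => D0.
  have {}D0 : D 0 = 0 by move/eqP: D0; rewrite -subr_eq0 opprD addrA subrr sub0r oppr_eq0 => /eqP.
  by rewrite D0 addr0 /GRing.scale /= mulr1 mulrC.
apply: rnorm_le_small => e e0.
(* The summand 1 keeps [K] positive when the rectangle is a point. *)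
pose K := 4 * (X + Y) ^+ 2 + 1.
have K0 : 0 < K by rewrite ltr_wpDl// mulr_ge0 ?sqr_ge0.
have [d d0 hd] := oD (e / K) (divr_gt0 e0 K0).
have [n hn] : exists n, (X + Y) / 2 ^+ n < d by apply: half_pow_lt => //; rewrite addr_ge0.
apply: le_trans (rs n) _.
have Ln : 0 <= (2 ^+ n : R)^-1 by rewrite invr_ge0 exprn_ge0.
have hXY : X / 2 ^+ n + Y / 2 ^+ n = (X + Y) / 2 ^+ n by exact/esym/mulrDl.
have : rnorm (r n (s n)) <= 4 * (e / K * ((X + Y) / 2 ^+ n)) * ((X + Y) / 2 ^+ n).
  have := @rectint_affine g (s n).1 ((s n).1 + X / 2 ^+ n) (s n).2
    ((s n).2 + Y / 2 ^+ n) (g (t +i* v)%C - D 1 * (t +i* v)%C) (D 1)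
    (e / K * ((X + Y) / 2 ^+ n)) cg.
  rewrite ?lerDl ?divr_ge0 ?exprn_ge0// => /(_ isT isT).
  have eK (q l : R) : q + l - q = l by rewrite addrC addKr.
  rewrite !eK hXY; apply=> x y hx' hy'.
  have pd : rnorm ((x +i* y)%C - (t +i* v)%C : C) <= (X + Y) / 2 ^+ n.
    apply: le_trans (rnorm_le_ReIm _) _; rewrite ReB ImB /= -hXY.
    move: (ht n) (hv n) hx' hy'; set a := X / _; set b := Y / _; set u := (s n).1.
    by set w := (s n).2; move=> *; apply: lerD; rewrite ler_norml; lra.
  have := hd _ (le_lt_trans pd hn); rewrite subrKC DE => h.
  rewrite (_ : _ - _ = g (x +i* y)%C - g (t +i* v)%C - D 1 * ((x +i* y)%C - (t +i* v)%C)).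
    apply: le_trans h _; rewrite ler_wpM2l// divr_ge0// ltW//.
  by ring.
move=> h; have : 4 ^+ n * rnorm (r n (s n)) <=
    4 ^+ n * (4 * (e / K * ((X + Y) / 2 ^+ n)) * ((X + Y) / 2 ^+ n)).
  by rewrite ler_wpM2l// exprn_ge0.
move=> /le_trans; apply.
have -> : 4 ^+ n * (4 * (e / K * ((X + Y) / 2 ^+ n)) * ((X + Y) / 2 ^+ n)) =
    e * ((4 * (X + Y) ^+ 2) / K).
  have -> : 4 ^+ n = 2 ^+ n * 2 ^+ n :> R by rewrite -exprMn; congr (_ ^+ _); ring.
  by field; rewrite gt_eqF// expf_neq0.
by rewrite ger_pMr// ler_pdivrMr// mul1r /K lerDl.
Qed.

End Goursat.

(** * Difference quotients and Goursat's theorem with one exceptional point *)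

Section LipschitzEstimate.
Variable R : realType.
Local Notation C := (CC R).
Implicit Types (g h : C -> C) (z w : C).

(** Cutting out a square of half side [m] around [p] leaves four rectangles that avoid [p], where
    [goursat] applies; by continuity at [p] the square itself contributes at most [16 * m]. *)
Lemma goursat_puncture g x0 x1 y0 y1 (p : C) : continuous g ->
  x0 < complex.Re p < x1 -> y0 < complex.Im p < y1 ->
  (forall x y, x0 <= x <= x1 -> y0 <= y <= y1 -> (x +i* y)%C != p ->
     exists D, has_diff g (x +i* y)%C D) ->
  rectint g x0 x1 y0 y1 = 0.
Proof.
move=> cg /andP[xp px] /andP[yp py] dg.
have [d d0 hd] := (continuous_rnormP g p).1 (cg p) 1 ltr01.
apply: rnorm_le_small => e e0.
(* [d / 4] keeps the square where [g] is within 1 of [g p]; [e / 16] matches the bound of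
   [rectint_affine] for side [2 * m] and error 1. *)
pose m := Num.min (Num.min (complex.Re p - x0) (x1 - complex.Re p))
  (Num.min (Num.min (complex.Im p - y0) (y1 - complex.Im p)) (Num.min (d / 4) (e / 16))).
have m0 : 0 < m by rewrite !lt_min !subr_gt0 xp px yp py !divr_gt0.
have : m <= m by []. rewrite {2}/m !le_min.
move=> /andP[/andP[m1 m2] /andP[/andP[m3 m4] /andP[m5 m6]]].
have neq x y : x != complex.Re p \/ y != complex.Im p -> (x +i* y)%C != p.
  by move=> h; rewrite eq_complex /= negb_and; apply/orP.
move: m m0 m1 m2 m3 m4 m5 m6 xp px yp py hd neq.
set a := complex.Re p; set b := complex.Im p => m m0 m1 m2 m3 m4 m5 m6 xp px yp py hd neq.
have [k1 k2 k3 k4] : [/\ x0 <= a - m, a + m <= x1, y0 <= b - m & b + m <= y1].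
  by split; lra.
have [k5 k6] : a - m <= a + m /\ b - m <= b + m by split; lra.
have zero u0 u1 v0 v1 : u0 <= u1 -> v0 <= v1 -> x0 <= u0 -> u1 <= x1 ->
    y0 <= v0 -> v1 <= y1 -> [\/ u1 < a, a < u0, v1 < b | b < v0] ->
    rectint g u0 u1 v0 v1 = 0.
  move=> *; apply: goursat => // x y /andP[xu ux] /andP[yv vy].
  apply: dg; [apply/andP; split|apply/andP; split|].
  - exact: le_trans xu.
  - exact: le_trans ux _.
  - exact: le_trans yv.
  - exact: le_trans vy _.
  - apply: neq; have [h|h|h|h] : [\/ u1 < a, a < u0, v1 < b | b < v0] by [].
    + by left; rewrite lt_eqF// (le_lt_trans ux).
    + by left; rewrite gt_eqF// (lt_le_trans h).
    + by right; rewrite lt_eqF// (le_lt_trans vy).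
    + by right; rewrite gt_eqF// (lt_le_trans h).
have [am ma] : a - m < a /\ a < a + m by split; lra.
have [bm mb] : b - m < b /\ b < b + m by split; lra.
have y01 : y0 <= y1 := le_trans (ltW yp) (ltW py).
rewrite (rectint_splitx y0 y1 cg k1 (le_trans k5 k2)).
rewrite (rectint_splitx y0 y1 cg k5 k2).
rewrite (rectint_splity (a - m) (a + m) cg k3 (le_trans k6 k4)).
rewrite (rectint_splity (a - m) (a + m) cg k6 k4).
rewrite (zero x0 (a - m) y0 y1)//; [|exact: le_trans k5 k2|by constructor 1].
rewrite (zero (a - m) (a + m) y0 (b - m))//; [|exact: le_trans k6 k4|by constructor 3].
rewrite (zero (a - m) (a + m) (b + m) y1)//; [|exact: le_trans k3 k6|by constructor 4].
rewrite (zero (a + m) x1 y0 y1)//; [|exact: le_trans k1 k5|by constructor 2].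
rewrite !add0r !addr0.
have := @rectint_affine R g (a - m) (a + m) (b - m) (b + m) (g p) 0 1 cg k5 k6.
move=> /(_ _)/le_trans; apply; last by lra.
move=> x y hx hy; rewrite mul0r addr0 ltW// hd//.
apply: le_lt_trans (rnorm_le_ReIm _) _; rewrite ReB ImB /=.
have hx' : `|x - a| <= m by rewrite ler_norml; lra.
have hy' : `|y - b| <= m by rewrite ler_norml; lra.
apply: le_lt_trans (lerD hx' hy') _; lra.
Qed.

Lemma has_diff_continuous (V W : normedModType C) (f : V -> W) (x : V) D :
  has_diff f x D -> {for x, continuous f}.
Proof.
by move=> h; apply/differentiable_continuous/differentiable_has_diff; exists D.
Qed.

Lemma has_diff_C g z (D : C -> C) k : has_diff g z D -> D k = k * D 1.
Proof.
case=> lD _ _; have := lD k 1 0; have := lD 1 0 0; rewrite !scale1r !addr0 => D0.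
have {}D0 : D 0 = 0.
  by move/eqP: D0; rewrite -subr_eq0 opprD addrA subrr sub0r oppr_eq0 => /eqP.
by rewrite D0 addr0 /GRing.scale /= mulr1.
Qed.

(** With [d] the derivative at [w], the quotient is continuous across [w] and inherits
    differentiability elsewhere, which is what [goursat_puncture] asks for. *)
Definition slope g (w : C) (d : C) (z : C) : C :=
  if z == w then d else (g z - g w) * (z - w)^-1.

Lemma near_neq (z w : C) : z != w -> \forall y \near z, y != w.
Proof.
move=> zw; apply/(@near_rnormP R C); exists (rnorm (z - w)); first by rewrite rnorm_gt0 subr_eq0.
by move=> y; apply: contraTneq => ->; rewrite rnorm_distC ltxx.
Qed.

Lemma slope_differentiable g w d z : z != w -> differentiable g z ->
  differentiable (slope g w d) z.
Proof.
move=> zw dg; apply: (@near_eq_differentiable _ _ _ (fun z => (g z - g w) * (z - w)^-1)).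
  by apply: filterS (near_neq zw) => y yw; rewrite /slope (negbTE yw).
apply: differentiableM.
  by apply: differentiableB => //; exact: differentiable_cst.
apply: differentiableV; last by rewrite subr_eq0.
by apply: differentiableB => //; exact: differentiable_cst.
Qed.

Lemma slope_continuous g w D : continuous g -> has_diff g w D ->
  continuous (slope g w (D 1)).
Proof.
move=> cg dg z; have [->{z}|zw] := eqVneq z w.
  apply/continuous_rnormP => e e0; have [_ _ oD] := dg.
  have e20 : 0 < e / 2 by rewrite divr_gt0.
  have [d d0 hd] := oD (e / 2) e20.
  exists d => // y /hd; rewrite subrKC (has_diff_C _ dg) /slope eqxx.
  have [->|yw] := eqVneq y w; first by move=> _; rewrite subrr rnorm0.
  have yw0 : 0 < rnorm (y - w) by rewrite rnorm_gt0 subr_eq0.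
  have yw1 : y - w != 0 by rewrite subr_eq0.
  rewrite (_ : g y - g w - _ = ((g y - g w) / (y - w) - D 1) * (y - w)); last by field.
  by rewrite rnormM ler_pM2r// => h; lra.
have cq : {for z, continuous (fun z => (g z - g w) * (z - w)^-1)}.
  apply: continuousM; first by apply: continuousB; [exact: cg|exact: cst_continuous].
  apply: continuousV; first by rewrite subr_eq0.
  by apply: continuousB; [exact: cvg_id|exact: cst_continuous].
apply/continuous_rnormP => e e0.
have [d1 d10 h1] := (continuous_rnormP _ _).1 cq e e0.
have /(@near_rnormP R C)[d2 d20 h2] := near_neq zw.
exists (Num.min d1 d2); first by rewrite lt_min d10.
move=> y; rewrite lt_min => /andP[/h1 y1 /h2 y2].
by rewrite /slope (negbTE y2) (negbTE zw).
Qed.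

End LipschitzEstimate.

(** * Cauchy estimates *)

Section LipschitzUnit.
Variable R : realType.
Local Notation C := (CC R).
Implicit Types (g h : C -> C) (z w : C).

Lemma rnorm_mono z w : `|complex.Re z| <= `|complex.Re w| ->
  `|complex.Im z| <= `|complex.Im w| -> rnorm z <= rnorm w.
Proof.
have sqn (a : R) : a ^+ 2 = `|a| ^+ 2 by rewrite real_normK ?num_real.
move=> hr hi; rewrite -(@ler_pXn2r _ 2)// ?nnegrE ?rnorm_ge0// !rnorm_sqr.
by apply: lerD; rewrite sqn [leRHS]sqn lerXn2r// nnegrE.
Qed.

Lemma Re_inv z : complex.Re (z^-1) = complex.Re z / rnorm z ^+ 2.
Proof. by rewrite rnorm_sqr; case: z. Qed.

Lemma Im_inv z : complex.Im (z^-1) = - (complex.Im z / rnorm z ^+ 2).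
Proof. by rewrite rnorm_sqr; case: z. Qed.

Lemma div_lower (a s : R) : 1 / 2 <= a -> a ^+ 2 <= s -> s <= 9 / 2 -> 1 / 9 <= a / s.
Proof.
move=> a1 a2 s1; have s0 : 0 < s.
  by apply: lt_le_trans a2; rewrite exprn_gt0//; lra.
by rewrite ler_pdivlMr//; lra.
Qed.

(* The difference [u] of the slopes of [g] at [w] and at [0] has boundary      *)
(* integral [0] over the square, and it differs from [1 / (z - w)] by at most  *)
(* [4 * M * rnorm w] there; but the imaginary part of the boundary integral of *)
(* [1 / (z - w)] is bounded below.  No value of this integral is needed.       *)
Lemma lipschitz_clamped g M w : continuous g ->
  (forall x y, -1 <= x <= 1 -> -1 <= y <= 1 -> exists D, has_diff g (x +i* y)%C D) ->
  (forall z, rnorm (g z) <= M) -> rnorm w <= 1 / 2 -> g w - g 0 = -1 ->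
  1 <= 36 * M * rnorm w.
Proof.
move=> cg dg gM w1 gw.
have [wr wi] : `|complex.Re w| <= 1 / 2 /\ `|complex.Im w| <= 1 / 2.
  by split; [apply: le_trans (Re_le_rnorm _) _|apply: le_trans (Im_le_rnorm _) _].
move: wr wi; rewrite !ler_norml => wr wi.
have [Dw hDw] : exists D, has_diff g w D.
  by case: (w) wr wi => a b /= wr wi; apply: dg; lra.
have [D0 hD0] : exists D, has_diff g 0 D by apply: dg; lra.
have cw := slope_continuous cg hDw; have c0 := slope_continuous cg hD0.
set u := slope g w (Dw 1) \- slope g 0 (D0 1).
have cu : continuous u by move=> z; apply: continuousB; [exact: cw|exact: c0].
have zero v D : -1 < complex.Re v < 1 -> -1 < complex.Im v < 1 -> has_diff g v D ->
    rectint (slope g v (D 1)) (-1) 1 (-1) 1 = 0.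
  move=> hr hi hD.
  apply: (goursat_puncture (slope_continuous cg hD) hr hi) => x y hx hy xv.
  apply/differentiable_has_diff.
  apply: slope_differentiable; first exact: xv.
  apply/differentiable_has_diff.
  exact: dg.
have Iu : rectint u (-1) 1 (-1) 1 = 0.
  have := rectintB (-1) 1 (-1) 1 cw c0; rewrite -/u zero//; [|lra|lra].
  by rewrite (@zero 0)//= ?oppr_lt0 ?ltr01 ?addr0.
set tau := 4 * M * rnorm w.
have bnd (z : C) : 1 <= rnorm z -> 1 / 2 <= rnorm (z - w) ->
    rnorm (u z - (z - w)^-1) <= tau.
  move=> z1 zw; have z0 : z != 0 by rewrite -rnorm_gt0; lra.
  have zw0 : z - w != 0 by rewrite -rnorm_gt0; lra.
  have zw1 : z != w by rewrite -subr_eq0.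
  rewrite /u /slope /= (negbTE z0) (negbTE zw1) subr0.
  (* The numerators of the two quotients now differ by 1, which leaves the term [(z - w)^-1] and a
     remainder with a factor [w]. *)
  have -> : g w = g 0 - 1 by rewrite -gw addrC subrK.
  rewrite (_ : _ - _ - _ = (g z - g 0) * (w * (z^-1 * (z - w)^-1))); last first.
    by field; rewrite z0 zw0.
  rewrite !rnormM !rnormV /tau.
  have b1 : rnorm (g z - g 0) <= 2 * M.
    by apply: le_trans (rnormB _ _) _; have := gM z; have := gM 0; lra.
  have b2 : (rnorm z)^-1 * (rnorm (z - w))^-1 <= 2.
    rewrite -[leRHS]mul1r ler_pM ?invr_ge0 ?rnorm_ge0// ?invf_le1//; first by lra.
    by rewrite -[leRHS]invrK lef_pV2 ?posrE//; lra.
  have M0 : 0 <= M := le_trans (rnorm_ge0 _) (gM 0).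
  rewrite (_ : 4 * M * rnorm w = (2 * M) * (rnorm w * 2)); last by ring.
  rewrite ler_pM ?rnorm_ge0 ?mulr_ge0 ?invr_ge0 ?rnorm_ge0//.
  by rewrite ler_wpM2l ?rnorm_ge0.
have big (z : C) : (`|complex.Re z| <= 1 /\ `|complex.Im z| <= 1) ->
    (`|complex.Re z| = 1 \/ `|complex.Im z| = 1) ->
    rnorm (u z - (z - w)^-1) <= tau /\ rnorm (z - w) ^+ 2 <= 9 / 2.
  move=> [zr zi] z1; split; last first.
    rewrite rnorm_sqr ReB ImB.
    have k (a b : R) : `|a| <= 1 -> - (1 / 2) <= b <= 1 / 2 -> (a - b) ^+ 2 <= (3 / 2) ^+ 2.
      move=> a1 b1; rewrite -(real_normK (num_real _)) lerXn2r ?nnegrE//.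
      by move: a1; rewrite !ler_norml; lra.
    have k1 := k _ _ zr wr; have k2 := k _ _ zi wi.
    by apply: le_trans (lerD k1 k2) _; lra.
  apply: bnd.
    by case: z1 => <-; [exact: Re_le_rnorm|exact: Im_le_rnorm].
  case: z1 => z1.
    apply: le_trans (Re_le_rnorm _); rewrite ReB; apply: le_trans (lerB_dist _ _).
    rewrite z1; have : `|complex.Re w| <= 1 / 2 by rewrite ler_norml.
    lra.
  apply: le_trans (Im_le_rnorm _); rewrite ImB; apply: le_trans (lerB_dist _ _).
  rewrite z1; have : `|complex.Im w| <= 1 / 2 by rewrite ler_norml.
  lra.
have ReN (z p : C) : rnorm (u z - p) <= tau -> `|complex.Re (u z) - complex.Re p| <= tau.
  by apply: le_trans; rewrite -ReB; exact: Re_le_rnorm.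
have ImN (z p : C) : rnorm (u z - p) <= tau -> `|complex.Im (u z) - complex.Im p| <= tau.
  by apply: le_trans; rewrite -ImB; exact: Im_le_rnorm.
have sqRe (z : C) : complex.Re z ^+ 2 <= rnorm z ^+ 2 by rewrite rnorm_sqr lerDl sqr_ge0.
have sqIm (z : C) : complex.Im z ^+ 2 <= rnorm z ^+ 2 by rewrite rnorm_sqr lerDr sqr_ge0.
have n11 : `|1| = 1 :> R by rewrite normr1.
have nN1 : `|-1| = 1 :> R by rewrite normrN1.
(* On each side, one component of [(z - w)^-1] has constant sign and modulus at least (1/2) / (9/2)
   = 1/9: [w] stays 1/2 away from the side, and |z - w|^2 is at most 9/2. *)
have bot x : -1 <= x <= 1 -> 1 / 9 - tau <= complex.Im (u (x +i* (-1))%C).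
  move=> hx; have [|/=|h1 h2] := big (x +i* (-1))%C; first by rewrite /= nN1 lexx ler_norml.
    by right.
  have := ImN _ _ h1; rewrite Im_inv ImB /=.
  have : 1 / 9 <= (1 + complex.Im w) / rnorm ((x +i* (-1))%C - w : C) ^+ 2.
    apply: div_lower => //; first by lra.
    by apply: le_trans (sqIm _); rewrite ImB /= -[leRHS]sqrrN opprB addrC opprK.
  rewrite (_ : -1 - complex.Im w = - (1 + complex.Im w)) ?mulNr; last by ring.
  by rewrite opprK ler_norml; lra.
have top x : -1 <= x <= 1 -> 1 / 9 - tau <= - complex.Im (u (x +i* 1)%C).
  move=> hx; have [|/=|h1 h2] := big (x +i* 1)%C; first by rewrite /= n11 lexx ler_norml.
    by right.
  have := ImN _ _ h1; rewrite Im_inv ImB /=.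
  have : 1 / 9 <= (1 - complex.Im w) / rnorm ((x +i* 1)%C - w : C) ^+ 2.
    apply: div_lower => //; first by lra.
    by apply: le_trans (sqIm _); rewrite ImB.
  by rewrite ler_norml; lra.
have rgt y : -1 <= y <= 1 -> 1 / 9 - tau <= complex.Re (u (1 +i* y)%C).
  move=> hx; have [|/=|h1 h2] := big (1 +i* y)%C; first by rewrite /= n11 lexx ler_norml.
    by left.
  have := ReN _ _ h1; rewrite Re_inv ReB /=.
  have : 1 / 9 <= (1 - complex.Re w) / rnorm ((1 +i* y)%C - w : C) ^+ 2.
    apply: div_lower => //; first by lra.
    by apply: le_trans (sqRe _); rewrite ReB.
  by rewrite ler_norml; lra.
have lft y : -1 <= y <= 1 -> 1 / 9 - tau <= - complex.Re (u (-1 +i* y)%C).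
  move=> hx; have [|/=|h1 h2] := big (-1 +i* y)%C; first by rewrite /= nN1 lexx ler_norml.
    by left.
  have := ReN _ _ h1; rewrite Re_inv ReB /=.
  have : 1 / 9 <= (1 + complex.Re w) / rnorm ((-1 +i* y)%C - w : C) ^+ 2.
    apply: div_lower => //; first by lra.
    by apply: le_trans (sqRe _); rewrite ReB /= -[leRHS]sqrrN opprB addrC opprK.
  rewrite (_ : -1 - complex.Re w = - (1 + complex.Re w)) ?mulNr; last by ring.
  by rewrite ler_norml; lra.
(* The four sides together give an imaginary part of at least [8 * (1 / 9 - tau)], while the
   integral is 0. *)
suff : 1 / 9 <= tau by rewrite /tau; lra.
have [_ ch] := ccontinuousB (ccontinuous_hor (-1) cu) (ccontinuous_hor 1 cu).
have [cv _] := ccontinuousB (ccontinuous_ver 1 cu) (ccontinuous_ver (-1) cu).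
have ccst (k : R) : continuous (fun _ : R => k) by move=> ?; exact: cst_continuous.
have : complex.Im (rectint u (-1) 1 (-1) 1) = 0 by rewrite Iu.
rewrite /rectint raddfD /= !mul0r !mul1r add0r => e.
have i1 : rint (-1) 1 (fun=> 2 * (1 / 9 - tau)) <= rint (-1) 1
    (@complex.Im R \o (fun x => u (x +i* (-1))%C - u (x +i* 1)%C)).
  by apply: rint_le => // x hx /=; rewrite ImB; have := bot x hx; have := top x hx; lra.
have i2 : rint (-1) 1 (fun=> 2 * (1 / 9 - tau)) <= rint (-1) 1
    (@complex.Re R \o (fun y => u (1 +i* y)%C - u (-1 +i* y)%C)).
  by apply: rint_le => // x hx /=; rewrite ReB; have := rgt x hx; have := lft x hx; lra.
move: i1 i2 e; rewrite rint_cst; last by lra.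
lra.
Qed.

End LipschitzUnit.

(** * From the unit square to balls: Lipschitz and second-order estimates *)

Section LipschitzBall.
Variable R : realType.
Local Notation C := (CC R).
Implicit Types (g h : C -> C) (z w : C).

Definition clamp (c t : R) : R := Num.max (- c) (Num.min t c).

Lemma clamp_bound (c t : R) : 0 <= c -> `|clamp c t| <= c.
Proof. by move=> c0; rewrite ler_norml /clamp le_max ge_max ge_min !lexx /= !orbT; lra. Qed.

Lemma clamp_id (c t : R) : `|t| <= c -> clamp c t = t.
Proof.
rewrite ler_norml => /andP[t1 t2]; rewrite /clamp (min_idPl _)//.
by apply/max_idPr.
Qed.

Lemma clamp_lip (c s t : R) : `|clamp c s - clamp c t| <= `|s - t|.
Proof.
rewrite /clamp /Num.max /Num.min.
by do ![case: ifPn => //]; rewrite -?leNgt => *; rewrite ler_norml; apply/andP; split;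
  case: (lerP 0 (s - t)) => st; rewrite ?(ger0_norm st) ?(ltr0_norm st); lra.
Qed.

(* Precomposing with a clamp to a square makes [h] continuous everywhere, so   *)
(* that no continuity relative to a subset is needed.                          *)
Lemma lipschitz_unit h M w :
  (forall z, rnorm z < 2 -> exists D, has_diff h z D) ->
  (forall z, rnorm z < 2 -> rnorm (h z) <= M) -> rnorm w <= 1 / 2 ->
  rnorm (h w - h 0) <= 36 * M * rnorm w.
Proof.
move=> dh hM w1.
(* The square of half side 5/4 fits in the disc of radius 2 and contains a neighbourhood of the
   square of half side 1, so [h \o k] agrees with [h] near the latter. *)
pose k z : C := (clamp (5 / 4) (complex.Re z) +i* clamp (5 / 4) (complex.Im z))%C.
have k2 z : rnorm (k z) < 2.
  rewrite -(@ltr_pXn2r _ 2)// ?nnegrE ?rnorm_ge0// rnorm_sqr /=.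
  have b t : clamp (5 / 4) t ^+ 2 <= (5 / 4) ^+ 2 :> R.
    rewrite -(real_normK (num_real _)) lerXn2r ?nnegrE ?divr_ge0//.
    by apply: clamp_bound; rewrite divr_ge0.
  by apply: le_lt_trans (lerD (b _) (b _)) _; lra.
have klip z1 z2 : rnorm (k z1 - k z2) <= rnorm (z1 - z2).
  by apply: rnorm_mono; rewrite ?ReB ?ImB /=; exact: clamp_lip.
have kid z : `|complex.Re z| <= 5 / 4 -> `|complex.Im z| <= 5 / 4 -> k z = z.
  by move=> h1 h2; rewrite /k !clamp_id//; case: (z).
have ck : continuous (h \o k).
  move=> z; apply/continuous_rnormP => e e0.
  have [D hD] := dh _ (k2 z).
  have [d d0 hd] := (continuous_rnormP _ _).1 (has_diff_continuous hD) e e0.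
  by exists d => // y yz; apply: hd; apply: le_lt_trans (klip _ _) yz.
have dk (x y : R) : -1 <= x <= 1 -> -1 <= y <= 1 ->
    differentiable (h \o k) ((x +i* y)%C : C).
  move=> hx hy; have kxy : k (x +i* y)%C = (x +i* y)%C.
    by apply: kid; rewrite /= ler_norml; lra.
  have [D hD] := dh _ (k2 (x +i* y)%C); rewrite kxy in hD.
  apply: (@near_eq_differentiable _ _ _ h); last by apply/differentiable_has_diff; exists D.
  apply/(@near_rnormP R C); exists (1 / 4); first by lra.
  move=> z zxy; rewrite /= kid//.
  - have := le_lt_trans (Re_le_rnorm _) zxy; rewrite ReB /= ltr_norml ler_norml; lra.
  - have := le_lt_trans (Im_le_rnorm _) zxy; rewrite ImB /= ltr_norml ler_norml; lra.
have k0 : k 0 = 0.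
  by apply: kid; rewrite /= normr0 divr_ge0.
have kw : k w = w.
  by apply: kid; [apply: le_trans (Re_le_rnorm _) _|apply: le_trans (Im_le_rnorm _) _];
    apply: le_trans w1 _; lra.
have M0 : 0 <= M by apply: le_trans (rnorm_ge0 _) (hM 0 _); rewrite rnorm0.
have [E|E] := eqVneq (h w - h 0) 0.
  by rewrite E rnorm0 !mulr_ge0// rnorm_ge0.
(* Normalises the increment between 0 and [w] to -1. *)
pose c := - (h w - h 0)^-1.
have cg : continuous (fun z => c * (h \o k) z).
  move=> z; have ckz := ck z.
  have : {for z, continuous (fun z : C => c * (h \o k) z)}.
    by apply: continuousM; [exact: cst_continuous|exact: ckz].
  exact.
have := @lipschitz_clamped R (fun z => c * (h \o k) z) (rnorm c * M) w cg.
have E0 : 0 < rnorm (h w - h 0) by rewrite rnorm_gt0.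
move=> /(_ _ _ w1 _)H.
have : 1 <= 36 * (rnorm c * M) * rnorm w.
  apply: H.
  - move=> x y hx hy; apply/differentiable_has_diff; apply: differentiableM.
      exact: differentiable_cst.
    exact: dk.
  - by move=> z; rewrite rnormM ler_wpM2l ?rnorm_ge0// hM.
  - by rewrite /= k0 kw -mulrBr /c mulNr mulVf.
rewrite /c rnormN rnormV; set a := rnorm (h w - h 0) in E0 *.
rewrite (_ : _ * rnorm w = a^-1 * (36 * M * rnorm w)); last by ring.
by rewrite ler_pdivlMl// mulr1.
Qed.

Lemma has_diff_affine (U V W : normedModType C) (f : V -> W) (D : V -> W) (p : V)
    (L : U -> V) (t : U) (m : R) :
  linear L -> 0 < m -> (forall u, rnorm (L u) <= m * rnorm u) ->
  has_diff f (p + L t) D -> has_diff (fun t => f (p + L t)) t (D \o L).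
Proof.
move=> lL m0 bL [lD [k bD] oD]; split.
- by move=> a u v /=; rewrite lL lD.
- exists (`|k| * m) => u /=; apply: le_trans (bD _) _.
  rewrite -mulrA; apply: le_trans (ler_wpM2r (rnorm_ge0 _) (ler_norm k)) _.
  by rewrite ler_wpM2l.
- move=> e e0; have [d d0 hd] := oD (e / m) (divr_gt0 e0 m0).
  exists (d / m); first by rewrite divr_gt0.
  move=> u; rewrite ltr_pdivlMr// mulrC => um.
  have ld : rnorm (L u) < d := le_lt_trans (bL u) um.
  have := hd _ ld; have -> : L (t + u) = L t + L u.
    by have := lL 1 t u; rewrite !scale1r.
  rewrite addrA => /le_trans; apply.
  by rewrite -mulrA ler_wpM2l ?(ltW e0)// ler_pdivrMl.
Qed.

(** Restriction to the complex line through [p] in direction [w]. The scale [s] sends the disc of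
    radius 2 into the ball of radius [rho], and [w] is the image of [s^-1], which is at most 1/2. *)
Lemma lipschitz_ball (V : normedModType C) (h : V -> C) (p : V) (rho M : R) (w : V) :
  0 < rho -> (forall q, rnorm (q - p) < rho -> exists D, has_diff h q D) ->
  (forall q, rnorm (q - p) < rho -> rnorm (h q) <= M) -> rnorm w <= rho / 4 ->
  rnorm (h (p + w) - h p) <= 72 * M / rho * rnorm w.
Proof.
move=> r0 dh hM w1.
have [->|w0] := eqVneq w 0; first by rewrite addr0 subrr !rnorm0 mulr0.
have nw : 0 < rnorm w by rewrite rnorm_gt0.
pose s : R := rho / (2 * rnorm w).
have s0 : 0 < s by rewrite divr_gt0// mulr_gt0.
pose L (t : C) : V := (t * s%:C%C) *: w.
have lL : linear L by move=> a u v; rewrite /L mulrDl scalerDl scalerA -mulrA.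
have bL u : rnorm (L u) = rho / 2 * rnorm u.
  rewrite /L rnormZ rnormM rnormR gtr0_norm// /s; field; rewrite gt_eqF//.
have inb u : rnorm u < 2 -> rnorm (p + L u - p) < rho.
  by rewrite addrC addKr bL => h1; rewrite -ltr_pdivlMl ?divr_gt0// invf_div divfK ?gt_eqF.
have L0 : L 0 = 0 by rewrite /L mul0r scale0r.
have Ls : L (s^-1)%:C%C = w.
  by rewrite /L -rmorphM mulVf ?gt_eqF// rmorph1 scale1r.
have := @lipschitz_unit (fun t => h (p + L t)) M (s^-1)%:C%C.
rewrite rnormR (ger0_norm (_ : 0 <= s^-1)) ?invr_ge0 ?(ltW s0)//.
rewrite L0 Ls addr0.
have -> : 36 * M / s = 72 * M / rho * rnorm w by rewrite /s; field; rewrite !gt_eqF.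
apply.
- move=> z /inb/dh[D hD]; exists (D \o L).
  apply: (has_diff_affine lL (m := rho / 2)) => //; first by rewrite divr_gt0.
  by move=> u; rewrite bL.
- by move=> z /inb/hM.
- by rewrite /s invf_div ler_pdivrMr//; lra.
Qed.

Lemma has_diffB (V W : normedModType C) (f g : V -> W) (x : V) D E :
  has_diff f x D -> has_diff g x E -> exists F, has_diff (fun y => f y - g y) x F.
Proof.
move=> hf hg; apply/differentiable_has_diff; apply: (@differentiableB _ _ _ f g).
  by apply/differentiable_has_diff; exists D.
by apply/differentiable_has_diff; exists E.
Qed.

Lemma has_diff_shift (V W : normedModType C) (f : V -> W) (x s : V) D :
  has_diff f (x + s) D -> has_diff (fun y => f (y + s)) x D.
Proof.
move=> [lD bD oD]; split=> // e e0; have [d d0 hd] := oD e e0.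
by exists d => // u /hd; rewrite (addrAC x).
Qed.

(* The Lipschitz estimate is applied twice, to [h] and to its differences      *)
(* [q |-> h (q + s) - h q]; then [h (p + w) - h p] is telescoped into [N]      *)
(* such differences with [s = w / N].                                          *)
Lemma taylor_ball (V : normedModType C) (h : V -> C) (p : V) (rho M : R) (D : V -> C)
    (w : V) :
  0 < rho -> (forall q, rnorm (q - p) < rho -> exists D, has_diff h q D) ->
  (forall q, rnorm (q - p) < rho -> rnorm (h q) <= M) -> has_diff h p D ->
  rnorm w <= rho / 8 ->
  rnorm (h (p + w) - h p - D w) <= 144 ^+ 2 * M / rho ^+ 2 * rnorm w ^+ 2.
Proof.
move=> r0 dh hM hD w1; set K := 144 ^+ 2 * M / rho ^+ 2.
have [lD _ oD] := hD.
have rn : rho != 0 by rewrite gt_eqF.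
have lip1 s q : rnorm s <= rho / 8 -> rnorm (q - p) < rho / 2 ->
    rnorm (h (q + s) - h q) <= 144 * M / rho * rnorm s.
  move=> hs hq; have := @lipschitz_ball V h q (rho / 2) M s.
  have -> : 72 * M / (rho / 2) = 144 * M / rho by field.
  have inb y : rnorm (y - q) < rho / 2 -> rnorm (y - p) < rho.
    by move=> hy; apply: le_lt_trans (rnorm_triangle _ q _) _; lra.
  apply; [lra| | |lra].
  - by move=> y /inb/dh.
  - by move=> y /inb/hM.
have lip2 s v : rnorm s <= rho / 8 -> rnorm v <= rho / 8 ->
    rnorm ((h (p + v + s) - h (p + v)) - (h (p + s) - h p)) <= K * (rnorm s * rnorm v).
  move=> hs hv.
  have := @lipschitz_ball V (fun q => h (q + s) - h q) p (rho / 2)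
    (144 * M / rho * rnorm s) v.
  have -> : 72 * (144 * M / rho * rnorm s) / (rho / 2) * rnorm v =
    K * (rnorm s * rnorm v) by rewrite /K; field.
  apply; [lra| | |lra].
  - move=> q hq; have [D1 h1] : exists D, has_diff h (q + s) D.
      apply: dh; rewrite addrAC; apply: le_lt_trans (rnormD _ _) _; lra.
    have [D2 h2] : exists D, has_diff h q D by apply: dh; lra.
    exact: has_diffB (has_diff_shift h1) h2.
  - by move=> q hq; apply: lip1.
have M0 : 0 <= M by apply: le_trans (rnorm_ge0 _) (hM p _); rewrite subrr rnorm0.
have K0 : 0 <= K.
  by apply: divr_ge0; [apply: mulr_ge0 => //; exact: exprn_ge0|exact/exprn_ge0/ltW].
have D0 : D 0 = 0 by have := lD (-1) 0 0; rewrite scaler0 addr0 scaleN1r addNr.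
have DZ (c : C) u : D (c *: u) = c * D u by have := lD c u 0; rewrite !addr0 D0 addr0.
apply/ler_addgt0Pl => e e0.
(* With this precision the [N.+1] first-order errors at step [s] add up to at most [e]. *)
have e1 : 0 < e / (rnorm w + 1) by rewrite divr_gt0// ltr_wpDl ?rnorm_ge0.
have [d d0 hd] := oD _ e1.
have [N hN] : exists N : nat, rnorm w < N.+1%:R * d.
  exists (Num.bound (rnorm w / d)); rewrite -ltr_pdivrMr//.
  apply: lt_trans (archi_boundP _) _; first by rewrite divr_ge0 ?rnorm_ge0// ltW.
  by rewrite ltr_nat.
pose s : V := (N.+1%:R : C)^-1 *: w.
have N0 : (0 : R) < N.+1%:R by [].
have ns : rnorm s = rnorm w / N.+1%:R by rewrite rnormZ rnormV rnorm_nat mulrC.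
have Ns : (N.+1%:R : C) *: s = w by rewrite scalerA mulfV ?scale1r// pnatr_eq0.
have sd : rnorm s < d by rewrite ns ltr_pdivrMr// mulrC.
have sw : rnorm s <= rnorm w.
  by rewrite ns ler_pdivrMr// ler_peMr ?rnorm_ge0// ler1n.
have tele : h (p + w) - h p = \sum_(j < N.+1) (h (p + j%:R *: s + s) - h (p + j%:R *: s)).
  rewrite -(big_mkord xpredT (fun j => h (p + j%:R *: s + s) - h (p + j%:R *: s))).
  rewrite (@telescope_sumr_eq _ 0 N.+1 (fun j => h (p + j%:R *: s)))//.
    by rewrite Ns scale0r addr0.
  by move=> k _; rewrite -addrA -{2}[s]scale1r -scalerDl natr1.
have split : h (p + w) - h p - D w =
    \sum_(j < N.+1) ((h (p + j%:R *: s + s) - h (p + j%:R *: s)) - (h (p + s) - h p)) +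
    (N.+1%:R : C) * (h (p + s) - h p - D s).
  rewrite sumrB -tele sumr_const card_ord -mulr_natl.
  have -> : D w = (N.+1%:R : C) * D s by rewrite -DZ Ns.
  by ring.
have fld (a b c : R) : a != 0 -> a * (b * (c / a)) = b * c by move=> ?; field.
rewrite split; apply: le_trans (rnormD _ _) _; rewrite addrC; apply: lerD.
- rewrite rnormM rnorm_nat.
  have := hd s sd; rewrite ns => h1.
  have : N.+1%:R * rnorm (h (p + s) - h p - D s) <=
      N.+1%:R * (e / (rnorm w + 1) * (rnorm w / N.+1%:R)) by rewrite ler_pM2l.
  move/le_trans; apply.
  have -> : N.+1%:R * (e / (rnorm w + 1) * (rnorm w / N.+1%:R)) = e * (rnorm w / (rnorm w + 1)).
    by rewrite fld ?pnatr_eq0// mulrAC -mulrA.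
  by rewrite ger_pMr// ler_pdivrMr ?mul1r ?lerDl// ltr_wpDl ?rnorm_ge0.
- apply: le_trans (rnorm_sum _ _ _) _.
  have -> : K * rnorm w ^+ 2 = \sum_(j < N.+1) K * (rnorm s * rnorm w).
    have -> : rnorm s * rnorm w = rnorm w ^+ 2 / N.+1%:R by rewrite ns expr2 mulrAC.
    by rewrite sumr_const card_ord -[RHS]mulr_natl fld ?pnatr_eq0.
  apply: ler_sum => j _.
  have jw : rnorm ((j%:R : C) *: s) <= rnorm w.
    rewrite rnormZ rnorm_nat ns mulrCA ler_piMr ?rnorm_ge0//.
    by rewrite ler_pdivrMr ?mul1r ?ler_nat//; exact/ltnW/ltn_ord.
  apply: le_trans (lip2 _ _ _ _) _; [lra|lra|].
  by rewrite !ler_wpM2l// rnorm_ge0.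
Qed.

(** Three Taylor estimates combined so that the derivative cancels by linearity; only values of [h]
    remain. *)
Lemma second_difference_ball (V : normedModType C) (h : V -> C) (p : V) (rho M : R)
    (c : C) (u v : V) :
  0 < rho -> (forall q, rnorm (q - p) < rho -> exists D, has_diff h q D) ->
  (forall q, rnorm (q - p) < rho -> rnorm (h q) <= M) ->
  rnorm (c *: u + v) <= rho / 8 -> rnorm u <= rho / 8 -> rnorm v <= rho / 8 ->
  rnorm (h (p + (c *: u + v)) - h p - c * (h (p + u) - h p) - (h (p + v) - h p)) <=
  144 ^+ 2 * M / rho ^+ 2 *
    (rnorm (c *: u + v) ^+ 2 + rnorm c * rnorm u ^+ 2 + rnorm v ^+ 2).
Proof.
move=> r0 dh hM h1 h2 h3.
have [D hD] : exists D, has_diff h p D by apply: dh; rewrite subrr rnorm0.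
have t (q : V) := taylor_ball r0 dh hM hD (w := q).
have [lD _ _] := hD.
rewrite (_ : _ - _ - _ - _ = (h (p + (c *: u + v)) - h p - D (c *: u + v)) -
  c * (h (p + u) - h p - D u) - (h (p + v) - h p - D v)); last first.
  by rewrite lD /GRing.scale /=; ring.
apply: le_trans (rnormB _ _) _; rewrite [leRHS]mulrDr; apply: lerD; last exact: t.
apply: le_trans (rnormB _ _) _; rewrite [leRHS]mulrDr; apply: lerD; first exact: t.
by rewrite rnormM mulrCA ler_wpM2l ?rnorm_ge0// t.
Qed.

End LipschitzBall.

(** * Hermitian forms and bounded operators *)

Section HermitianForms.
Variables (R : realType) (H : lmodType (CC R)).
Local Notation C := (CC R).

(** Kept abstract because Cauchy-Schwarz serves both the inner product and the weighted form <P x,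
    y>. *)
Definition hermitian_form (B : H -> H -> C) : Prop :=
  (forall c x y z, B (c *: x + y) z = c * B x z + B y z) /\
  (forall x y, B x y = (B y x)^*).

Lemma Re_conj (z : C) : complex.Re (z^* : C) = complex.Re z.
Proof. by case: z. Qed.

Lemma mul_conj (z : C) : z * z^* = (rnorm z ^+ 2)%:C%C :> C.
Proof. by rewrite -normCK -rnormE rmorphXn. Qed.

Variable B : H -> H -> C.
Hypothesis hB : hermitian_form B.

Lemma hermDl x y z : B (x + y) z = B x z + B y z.
Proof. by have [h _] := hB; rewrite -[x]scale1r h scale1r mul1r. Qed.

Lemma herm0l z : B 0 z = 0.
Proof. by apply: (addIr (B 0 z)); rewrite -hermDl !add0r. Qed.

Lemma hermZl c x z : B (c *: x) z = c * B x z.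
Proof. by have [h _] := hB; rewrite -[c *: x]addr0 h herm0l addr0. Qed.

Lemma hermNl x z : B (- x) z = - B x z.
Proof. by rewrite -scaleN1r hermZl mulN1r. Qed.

Lemma hermBl x y z : B (x - y) z = B x z - B y z.
Proof. by rewrite hermDl hermNl. Qed.

Lemma hermC x y : B x y = (B y x)^*.
Proof. by have [_ ->] := hB. Qed.

Lemma hermDr x y z : B z (x + y) = B z x + B z y.
Proof. by rewrite hermC hermDl rmorphD /= -!hermC. Qed.

Lemma hermZr c x z : B z (c *: x) = c^* * B z x.
Proof. by rewrite hermC hermZl rmorphM /= -hermC. Qed.

Lemma hermNr x z : B z (- x) = - B z x.
Proof. by rewrite hermC hermNl rmorphN /= -hermC. Qed.

Lemma hermBr x y z : B z (x - y) = B z x - B z y.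
Proof. by rewrite hermDr hermNr. Qed.

Lemma herm_sqrD x y : complex.Re (B (x + y) (x + y)) =
  complex.Re (B x x) + 2 * complex.Re (B x y) + complex.Re (B y y).
Proof.
rewrite hermDl !hermDr !raddfD /= (hermC y x) Re_conj mulr_natl mulr2n.
by rewrite !addrA.
Qed.

(** Evaluating the form at [x] minus [t * B x y] times [y], for real [t], gives a nonnegative real
    quadratic. If the value at [y] vanishes it is affine in [t], which forces [B x y = 0]; otherwise
    [t] is the inverse of that value. *)
Lemma herm_CauchySchwarz x y : (forall x, 0 <= complex.Re (B x x)) ->
  rnorm (B x y) ^+ 2 <= complex.Re (B x x) * complex.Re (B y y).
Proof.
move=> B0; set s := rnorm (B x y) ^+ 2.
have s0 : 0 <= s by rewrite sqr_ge0.
have key (t : R) : 0 <= complex.Re (B x x) - 2 * t * s + t ^+ 2 * s * complex.Re (B y y).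
  have := B0 (x + (- t%:C%C * B x y) *: y).
  rewrite herm_sqrD !(hermZr, hermZl).
  have -> : (- t%:C%C * B x y)^* * B x y = (- (t * s))%:C%C :> C.
    have ct : (- t%:C%C * B x y)^* = - t%:C%C * (B x y)^* :> C.
      case: (B x y) => a c; rewrite -[LHS]/(conjc _) -[RHS]/(- t%:C%C * conjc _)%R.
      by apply/eqP; rewrite eq_complex /=; apply/andP; split; apply/eqP; ring.
    rewrite ct -mulrA (mulrC (B x y)^*) mul_conj.
    by rewrite mulNr -rmorphM -rmorphN.
  have -> : (- t%:C%C * B x y)^* * (- t%:C%C * B x y * B y y) =
      (t ^+ 2 * s)%:C%C * B y y :> C.
    rewrite mulrA (mulrC _^*) mul_conj rnormM rnormN rnormR exprMn real_normK ?num_real//.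
  rewrite ReM /= mul0r subr0; lra.
set b := complex.Re (B y y) in key *; have [b0|b0] := eqVneq b 0.
  rewrite b0 mulr0 leNgt; apply/negP => sp.
  have := key ((complex.Re (B x x) + 1) / (2 * s)); rewrite b0 mulr0 addr0.
  have := B0 x.
  rewrite (_ : 2 * _ * s = complex.Re (B x x) + 1); last by field; rewrite gt_eqF.
  lra.
have bp : 0 < b by rewrite lt_neqAle eq_sym b0 B0.
have := key b^-1; rewrite (_ : _ + _ = complex.Re (B x x) - s / b); last by field.
by rewrite subr_ge0 ler_pdivrMr.
Qed.

End HermitianForms.

Section BoundedOperatorConstructions.
Variables (R : realType) (H : normedModType (CC R)).
Local Notation C := (CC R).
Implicit Types (S T : bop H) (x y : H).

Lemma bop_linear T c x y : T (c *: x + y) = c *: T x + T y.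
Proof. by have [-> _] := bopP T. Qed.

Lemma bop0 T : T 0 = 0.
Proof.
by have := bop_linear T (-1) 0 0; rewrite scaler0 addr0 scaleN1r addNr.
Qed.

Lemma bopD T x y : T (x + y) = T x + T y.
Proof. by rewrite -[x]scale1r bop_linear !scale1r. Qed.

Lemma bopZ T c x : T (c *: x) = c *: T x.
Proof. by rewrite -[c *: x]addr0 bop_linear bop0 addr0. Qed.

Lemma bopN T x : T (- x) = - T x.
Proof. by rewrite -scaleN1r bopZ scaleN1r. Qed.

Lemma bopB T x y : T (x - y) = T x - T y.
Proof. by rewrite bopD bopN. Qed.

Lemma bop_addE S T x : (S + T) x = S x + T x. Proof. by []. Qed.
Lemma bop_oppE T x : (- T) x = - T x. Proof. by []. Qed.
Lemma bop_subE S T x : (S - T) x = S x - T x. Proof. by []. Qed.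
Lemma bop_scaleE c T x : (c *: T) x = c *: T x. Proof. by []. Qed.
Lemma bop_zeroE x : (0 : bop H) x = 0. Proof. by []. Qed.

Lemma bop_ext S T : S =1 T -> S = T.
Proof. by move=> ST; apply/val_inj/funext. Qed.

Lemma opnormP T x : rnorm (T x) <= opnorm T * rnorm x.
Proof.
have [->|x0] := eqVneq x 0; first by rewrite bop0 !rnorm0 mulr0.
have px : 0 < rnorm x by rewrite rnorm_gt0.
have c : rnorm ((rnorm x)^-1%:C%C : C) = (rnorm x)^-1.
  by rewrite rnormR ger0_norm// invr_ge0 ltW.
have := @opnorm_ub _ _ T (((rnorm x)^-1%:C%C : C) *: x).
rewrite bopZ !rnormZ c mulVf ?gt_eqF// lexx => /(_ isT).
by rewrite ler_pdivrMl// mulrC.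
Qed.

Lemma opnorm_le_mul T (M : R) : 0 <= M -> (forall x, rnorm (T x) <= M * rnorm x) ->
  opnorm T <= M.
Proof.
move=> M0 h; apply: opnorm_le => x x1; apply: le_trans (h x) _.
by rewrite ler_piMr.
Qed.

Lemma bop_exists (f : H -> H) (M : R) :
  (forall c x y, f (c *: x + y) = c *: f x + f y) ->
  (forall x, rnorm (f x) <= M * rnorm x) -> exists T : bop H, T =1 f.
Proof.
move=> lf bf; have fb : f \in @bounded_op R H by rewrite inE; split => //; exists M.
by exists (Bop fb).
Qed.

Lemma bcomp_subproof S T : (S \o T : H -> H) \in @bounded_op R H.
Proof.
rewrite inE; split; first by move=> c x y; rewrite /= !bop_linear.
exists (opnorm S * opnorm T) => x /=; apply: le_trans (opnormP _ _) _.
by rewrite -mulrA ler_wpM2l ?opnorm_ge0// opnormP.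
Qed.

Definition bcomp S T : bop H := Bop (bcomp_subproof S T).

Lemma bid_subproof : (id : H -> H) \in @bounded_op R H.
Proof. by rewrite inE; split => //; exists 1 => x; rewrite mul1r. Qed.

Definition bid : bop H := Bop bid_subproof.

Lemma bcompE S T x : bcomp S T x = S (T x). Proof. by []. Qed.

Lemma opnorm_comp S T : opnorm (bcomp S T) <= opnorm S * opnorm T.
Proof.
apply: opnorm_le_mul => [|x]; first by rewrite mulr_ge0 ?opnorm_ge0.
rewrite bcompE; apply: le_trans (opnormP _ _) _.
by rewrite -mulrA ler_wpM2l ?opnorm_ge0// opnormP.
Qed.

Lemma opnormD S T : opnorm (S + T) <= opnorm S + opnorm T.
Proof. by rewrite -!rnorm_bop rnormD. Qed.

Lemma opnormZ c T : opnorm (c *: T) = rnorm (c : C) * opnorm T.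
Proof. by rewrite -!rnorm_bop rnormZ. Qed.

Lemma opnorm_id : opnorm bid <= 1.
Proof. by apply: opnorm_le. Qed.

End BoundedOperatorConstructions.
Arguments bid {R H}.

Section HilbertSpace.
Variables (R : realType) (H : completeNormedModType (CC R)).
Local Notation C := (CC R).
Implicit Types (S T : bop H) (x y : H).

Definition inner_product (dot : H -> H -> C) : Prop :=
  hermitian_form dot /\ forall x, dot x x = (rnorm x ^+ 2)%:C%C.

Lemma hilbert_inner_product : hilbert_space H -> exists dot, inner_product dot.
Proof.
move=> [dot dotE]; exists (fun x y => dot x y); split; last first.
  by move=> x; rewrite dotE -rnormE rmorphXn.
split=> [c x y z|x y].
  by rewrite linearDl linearZl_LR.
by rewrite sesquilinear.hermC /= expr0 mul1r.
Qed.

Variable dot : H -> H -> C.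
Hypothesis hdot : inner_product dot.

Let hherm : hermitian_form dot := hdot.1.

Lemma dotxx x : complex.Re (dot x x) = rnorm x ^+ 2.
Proof. by rewrite hdot.2. Qed.

Lemma dot_CS x y : rnorm (dot x y) <= rnorm x * rnorm y.
Proof.
rewrite -(@ler_pXn2r _ 2)// ?nnegrE ?mulr_ge0 ?rnorm_ge0//.
have := @herm_CauchySchwarz R H dot hherm x y.
by rewrite !dotxx exprMn; apply=> z; rewrite dotxx sqr_ge0.
Qed.

Lemma dot_ext x y : (forall z, dot x z = dot y z) -> x = y.
Proof.
move=> h; apply/eqP; rewrite -subr_eq0; apply/eqP/rnorm_eq0/eqP.
by rewrite -sqrf_eq0 -dotxx hermBl// h subrr.
Qed.

Lemma complete_seq (x : nat -> H) (K : R) :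
  (forall m n, (m <= n)%N -> rnorm (x m - x n) ^+ 2 <= K / m.+1%:R) ->
  exists v, forall e : R, 0 < e -> exists N, forall n, (N <= n)%N -> rnorm (x n - v) < e.
Proof.
move=> h.
have small (e : R) : 0 < e -> exists N, forall n, (N <= n)%N -> rnorm (x N - x n) < e.
  move=> e0; have K0 : 0 <= K.
    by have := h 0%N 0%N isT; rewrite divr1; apply: le_trans; exact: sqr_ge0.
  exists (Num.bound (K / e ^+ 2)) => n /h.
  set N := Num.bound _ => h1.
  rewrite -(@ltr_pXn2r _ 2)// ?nnegrE ?rnorm_ge0 ?(ltW e0)//.
  apply: le_lt_trans h1 _; rewrite ltr_pdivrMr// mulrC -ltr_pdivrMr ?exprn_gt0//.
  apply: lt_trans (archi_boundP _) _; first by rewrite divr_ge0// exprn_ge0// ltW.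
  by rewrite ltr_nat.
have : cauchy (x @ \oo).
  apply: cauchy_exP => e; rewrite ltcE /= => /andP[/eqP ei e0].
  have [N hN] := small (complex.Re e) e0.
  exists (x N); exists N => // n Nn; rewrite -ball_normE /=.
  have -> : e = (complex.Re e)%:C%C by move: ei; case: (e) => a b /= ->.
  by rewrite -rnormE ltcR; exact: hN.
move=> /cauchy_cvgP/cvg_ex[v hv]; exists v => e e0.
have e0' : (0 : C) < e%:C%C by rewrite ltcR.
have /cvgrPdist_lt/(_ _ e0')[N _ hN] := hv.
by exists N => n /hN /=; rewrite -rnormE ltcR rnorm_distC.
Qed.
End HilbertSpace.

(** * Riesz representation and ultrafilter limits *)

Section Riesz.
Variables (R : realType) (H : completeNormedModType (CC R)).
Local Notation C := (CC R).
Implicit Types (S T : bop H) (x y : H).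
Variable dot : H -> H -> C.
Hypothesis hdot : inner_product dot.
Let hherm : hermitian_form dot := hdot.1.

Lemma quadratic_discriminant (a b c : R) : 0 <= a -> 0 <= c ->
  (forall t, 0 <= t ^+ 2 * a + 2 * t * b + c) -> b ^+ 2 <= a * c.
Proof.
move=> a0 c0 h; have [a1|a1] := eqVneq a 0.
  have [->|b1] := eqVneq b 0; first by rewrite expr0n /= a1 mul0r.
  have := h (- (c + 1) / (2 * b)); rewrite a1 mulr0 add0r.
  by rewrite (_ : 2 * _ * b = - (c + 1)); [lra|field].
have ap : 0 < a by rewrite lt_neqAle eq_sym a1.
have := h (- b / a); rewrite (_ : _ + c = c - b ^+ 2 / a); last by field.
by rewrite subr_ge0 ler_pdivrMr// mulrC.
Qed.

(** The representing vector minimises [J]. The parallelogram identity makes a minimising sequence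
    Cauchy, and the first variation of [J] at the limit is the wanted identity. *)
Lemma riesz (phi : H -> C) (M : R) :
  (forall c x y, phi (c *: x + y) = c * phi x + phi y) ->
  (forall x, rnorm (phi x) <= M * rnorm x) -> exists v, forall x, phi x = dot x v.
Proof.
move=> lphi bphi.
have phi0 : phi 0 = 0.
  by have := lphi (-1) 0 0; rewrite scaler0 addr0 mulN1r addNr.
have phiZ c x : phi (c *: x) = c * phi x by rewrite -[c *: x]addr0 lphi phi0 addr0.
have phiD x y : phi (x + y) = phi x + phi y by rewrite -[x]scale1r lphi scale1r mul1r.
pose J x := rnorm x ^+ 2 - 2 * complex.Re (phi x).
have Jlb x : - M ^+ 2 <= J x.
  have h : complex.Re (phi x) <= M * rnorm x.
    by apply: le_trans (le_trans (ler_norm _) (Re_le_rnorm _)) (bphi x).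
  by have := sqr_ge0 (rnorm x - M); rewrite /J; lra.
have hJ : has_inf (range J).
  by split; [exists (J 0), 0|exists (- M ^+ 2) => _ [x _ <-]].
pose m := inf (range J).
have mJ x : m <= J x by apply: ge_inf; [case: hJ|exists x].
have /boolp.choice[xs hxs] : forall n : nat, exists x : H, J x < m + n.+1%:R^-1.
  move=> n; have n0 : (0 : R) < n.+1%:R^-1 by rewrite invr_gt0.
  by have [_ [x _ <-] h] := inf_adherent n0 hJ; exists x.
have para x y : rnorm (x - y) ^+ 2 = 2 * J x + 2 * J y - 4 * J ((2^-1 : R)%:C%C *: (x + y)).
  rewrite /J rnormZ rnormR ger0_norm ?invr_ge0// exprMn phiZ phiD ReM /= mul0r subr0.
  rewrite -!(dotxx hdot) !(herm_sqrD hherm) (hermNr hherm) (hermNl hherm) (hermNr hherm).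
  by rewrite !raddfN raddfD /=; field.
have [v hv] : exists v, forall e : R, 0 < e ->
    exists N, forall n, (N <= n)%N -> rnorm (xs n - v) < e.
  apply: (@complete_seq _ _ xs 4) => p q pq; rewrite para.
  have hpq : (q.+1%:R : R)^-1 <= p.+1%:R^-1 by rewrite lef_pV2 ?posrE ?ltr0n// ler_nat.
  move: hpq (mJ ((2^-1 : R)%:C%C *: (xs p + xs q))) (hxs p) (hxs q).
  move: (J _) (J _) (J _) (_^-1) (_^-1) => j1 j2 j3 r1 r2; lra.
have key y : complex.Re (dot v y - phi y) = 0.
  (* A near-minimiser has a small first variation: [J (xs n + t y) - m] is nonnegative for all real
     [t], and its constant term is below [n.+1%:R^-1]. *)
  have disc n : complex.Re (dot (xs n) y - phi y) ^+ 2 <= rnorm y ^+ 2 * n.+1%:R^-1.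
    apply: quadratic_discriminant; rewrite ?sqr_ge0 ?invr_ge0// => t.
    have := mJ (xs n + t%:C%C *: y); have := hxs n.
    rewrite /J phiD phiZ -!(dotxx hdot) (herm_sqrD hherm) (hermZr hherm).
    rewrite (hermZl hherm) (hermZr hherm).
    have ct : (t%:C%C)^* = t%:C%C :> C by rewrite -[LHS]/(conjc _) conjc_real.
    have Rt z : complex.Re (t%:C%C * z : C) = t * complex.Re z by rewrite ReM /= mul0r subr0.
    by rewrite !ct ReB [complex.Re (phi _ + _)]raddfD /= !Rt; move: (_^-1) => r; lra.
  apply/eqP; rewrite -normr_eq0 eq_le normr_ge0 andbT; apply/ler_addgt0Pl => e e0.
  rewrite addr0; have e1 : 0 < e / (2 * (rnorm y + 1)).
    by rewrite divr_gt0// mulr_gt0// ltr_wpDl ?rnorm_ge0.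
  have [N hN] := hv _ e1.
  pose n := maxn N (Num.bound (rnorm y ^+ 2 / (e / 2) ^+ 2)).
  have e2 : 0 < e / 2 by rewrite divr_gt0.
  have dn : `|complex.Re (dot (xs n) y - phi y)| <= e / 2.
    rewrite -(@ler_pXn2r _ 2)// ?nnegrE ?(ltW e2)// real_normK ?num_real//.
    apply: le_trans (disc n) _; rewrite ler_pdivrMr// mulrC -ler_pdivrMr ?exprn_gt0//.
    apply: le_trans (ltW (archi_boundP _)) _; first by rewrite divr_ge0 ?sqr_ge0.
    by rewrite ler_nat /n ltnW// ltnS leq_maxr.
  have vn : rnorm (dot (xs n - v) y) <= e / 2.
    apply: le_trans (dot_CS hdot _ _) _.
    apply: le_trans (ler_wpM2r (rnorm_ge0 _) (ltW (hN n (leq_maxl _ _)))) _.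
    rewrite (_ : _ * rnorm y = e / 2 * (rnorm y / (rnorm y + 1))); last first.
      by field; rewrite gt_eqF// ltr_wpDl ?rnorm_ge0.
    rewrite ler_piMr ?(ltW e2)// ler_pdivrMr ?mul1r ?lerDl// ltr_wpDl ?rnorm_ge0//.
  rewrite (_ : dot v y - phi y = (dot (xs n) y - phi y) - dot (xs n - v) y); last first.
    by rewrite (hermBl hherm); ring.
  rewrite ReB; apply: le_trans (ler_normB _ _) _.
  have := le_trans (Re_le_rnorm _) vn; lra.
exists v => x; apply/eqP; rewrite -subr_eq0; apply/eqP.
have r1 y : complex.Re (phi y - dot y v) = 0.
  have := key y; rewrite ReB (hermC hherm v y) Re_conj ReB; lra.
(* The real part at ['i *: x] yields the imaginary part at [x]. *)
have := r1 ('i%C *: x); rewrite phiZ (hermZl hherm) -mulrBr ReM /= mul0r mul1r sub0r.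
move=> /eqP; rewrite oppr_eq0 => /eqP r2.
by move: (r1 x) r2; case: (phi x - dot x v) => a b /= -> ->.
Qed.

(** Riesz applies to the conjugate of [B x], which is linear; testing the form against [f x] itself
    bounds [f]. *)
Lemma sesquilinear_operator (B : H -> H -> C) (M : R) :
  0 <= M -> (forall c x y z, B (c *: x + y) z = c * B x z + B y z) ->
  (forall c x y z, B z (c *: x + y) = c^* * B z x + B z y) ->
  (forall x y, rnorm (B x y) <= M * rnorm x * rnorm y) ->
  exists T : bop H, (forall x y, dot (T x) y = B x y) /\ opnorm T <= M.
Proof.
move=> M0 lB rB bB.
have [f hf] : exists f : H -> H, forall x y, dot (f x) y = B x y.
  have : forall x, exists v, forall y, dot v y = B x y.
    move=> x; have [||v hv] := @riesz (fun y => (B x y)^*) (M * rnorm x).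
    - by move=> c y z; rewrite rB rmorphD rmorphM /= conjCK.
    - by move=> y; rewrite rnorm_conj; exact: bB.
    - by exists v => y; rewrite (hermC hherm) -hv conjCK.
  by move=> /boolp.choice[f hf]; exists f.
have bf x : rnorm (f x) <= M * rnorm x.
  have [->|fx] := eqVneq (f x) 0; first by rewrite rnorm0 mulr_ge0 ?rnorm_ge0.
  have fp : 0 < rnorm (f x) by rewrite rnorm_gt0.
  rewrite -(ler_pM2r fp); apply: le_trans (bB x (f x)).
  rewrite -hf -expr2 -(dotxx hdot).
  exact: le_trans (ler_norm _) (Re_le_rnorm _).
have lf c x y : f (c *: x + y) = c *: f x + f y.
  apply: (dot_ext hdot) => z; rewrite hf lB.
  by rewrite (hermDl hherm) (hermZl hherm) !hf.
have [T Tf] := bop_exists lf bf.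
exists T; split; first by move=> x y; rewrite Tf.
by apply: opnorm_le_mul => // x; rewrite Tf.
Qed.

Lemma adjoint_exists T : exists S : bop H, forall x y, dot (S x) y = dot x (T y).
Proof.
have [||||S [hS _]] := @sesquilinear_operator (fun x y => dot x (T y)) (opnorm T).
- exact: opnorm_ge0.
- by move=> c x y z; rewrite (hermDl hherm) (hermZl hherm).
- by move=> c x y z; rewrite bop_linear (hermDr hherm) (hermZr hherm).
- move=> x y; apply: le_trans (dot_CS hdot _ _) _.
  by rewrite mulrC mulrAC ler_wpM2r ?rnorm_ge0// opnormP.
- by exists S.
Qed.

Lemma adjoint_sym S T : (forall x y, dot (S x) y = dot x (T y)) ->
  forall x y, dot (T x) y = dot x (S y).
Proof. by move=> h x y; rewrite (hermC hherm) -h -(hermC hherm). Qed.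

Lemma opnorm_le_form T (M : R) : 0 <= M ->
  (forall x y, rnorm (dot (T x) y) <= M * rnorm x * rnorm y) -> opnorm T <= M.
Proof.
move=> M0 h; apply: opnorm_le_mul => // x.
have [->|fx] := eqVneq (T x) 0; first by rewrite rnorm0 mulr_ge0 ?rnorm_ge0.
have fp : 0 < rnorm (T x) by rewrite rnorm_gt0.
rewrite -(ler_pM2r fp); apply: le_trans (h x (T x)).
rewrite -expr2 -(dotxx hdot); exact: le_trans (ler_norm _) (Re_le_rnorm _).
Qed.

Lemma form_le T x y : rnorm (dot (T x) y) <= opnorm T * rnorm x * rnorm y.
Proof.
apply: le_trans (dot_CS hdot _ _) _.
by rewrite ler_wpM2r ?rnorm_ge0// opnormP.
Qed.

Lemma opnorm_adjoint S T : (forall x y, dot (S x) y = dot x (T y)) ->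
  opnorm S <= opnorm T.
Proof.
move=> h; apply: opnorm_le_form; first exact: opnorm_ge0.
move=> x y; rewrite h; apply: le_trans (dot_CS hdot _ _) _.
by rewrite mulrC mulrAC ler_wpM2r ?rnorm_ge0// opnormP.
Qed.

End Riesz.

Section UltrafilterLimits.
Variables (R : realType) (U : set_system nat).
Hypothesis UU : UltraFilter U.
Hypothesis Uoo : forall N, U [set n | (N <= n)%N].
Local Notation C := (CC R).
Implicit Types (u v : nat -> C).

Definition ulim u (l : C) : Prop :=
  forall e : R, 0 < e -> U [set n | rnorm (u n - l) < e].

Let UF : ProperFilter U := @ultra_proper _ _ UU.

Lemma ultra_meet (A : set nat) : U A -> exists n, A n.
Proof. exact: filter_ex. Qed.

(** The image of [U] under [u] is an ultrafilter containing a compact segment, hence it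
    converges. *)
Lemma ultra_bounded_real (u : nat -> R) (M : R) : U [set n | `|u n| <= M] ->
  exists l, forall e : R, 0 < e -> U [set n | `|u n - l| < e].
Proof.
move=> uM; have UG : UltraFilter (u @ U).
  split; first exact: fmap_proper_filter.
  move=> G PG sG; apply/seteqP; split=> A; last exact: sG.
  move=> GA; have [//|UA] := in_ultra_setVsetC (u @^-1` A) UU.
  have : G (~` A) by apply: sG.
  by move=> /(filterI GA); rewrite setICr => /filter_ex[].
have := @segment_compact R (- M) M; rewrite compact_ultra.
move=> /(_ (u @ U) UG); case.
  suff : U (u @^-1` `[- M, M]) by [].
  apply: filterS uM => n h; have {}h : `|u n| <= M := h.
  by change (u n \in `[- M, M]); rewrite in_itv /= -ler_norml.
move=> l [_ /cvgrPdist_lt hl]; exists l => e e0.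
by apply: filterS (hl e e0) => n /=; rewrite distrC.
Qed.

Lemma ulim_exists u (M : R) : U [set n | rnorm (u n) <= M] -> exists l, ulim u l.
Proof.
move=> uM.
have [a ha] : exists l, forall e : R, 0 < e -> U [set n | `|complex.Re (u n) - l| < e].
  apply: (@ultra_bounded_real _ M); apply: filterS uM => n /=.
  exact: le_trans (Re_le_rnorm _).
have [b hb] : exists l, forall e : R, 0 < e -> U [set n | `|complex.Im (u n) - l| < e].
  apply: (@ultra_bounded_real _ M); apply: filterS uM => n /=.
  exact: le_trans (Im_le_rnorm _).
exists (a +i* b)%C => e e0; have e2 : 0 < e / 2 by rewrite divr_gt0.
apply: filterS2 (ha _ e2) (hb _ e2) => n /= h1 h2.
by apply: le_lt_trans (rnorm_le_ReIm _) _; rewrite ReB ImB /=; lra.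
Qed.

Lemma ulim_le u l (b : R) : ulim u l -> U [set n | rnorm (u n) <= b] -> rnorm l <= b.
Proof.
move=> ul ub; apply/ler_addgt0Pl => e e0.
have [n [/= h1 h2]] := ultra_meet (filterI (ul e e0) ub).
have := rnormB (u n) (u n - l); rewrite opprB addrC subrK; lra.
Qed.

Lemma ulim_unique u l1 l2 : ulim u l1 -> ulim u l2 -> l1 = l2.
Proof.
move=> h1 h2; apply/eqP; rewrite -subr_eq0; apply/eqP/rnorm_le_small => e e0.
have e2 : 0 < e / 2 by rewrite divr_gt0.
have [n [/= h3 h4]] := ultra_meet (filterI (h1 _ e2) (h2 _ e2)).
have := rnorm_triangle l1 (u n) l2; rewrite (rnorm_distC l1 (u n)); lra.
Qed.

Lemma ulimD u v l k : ulim u l -> ulim v k -> ulim (fun n => u n + v n) (l + k).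
Proof.
move=> h1 h2 e e0; have e2 : 0 < e / 2 by rewrite divr_gt0.
apply: filterS2 (h1 _ e2) (h2 _ e2) => n /= h3 h4.
by rewrite opprD addrACA; apply: le_lt_trans (rnormD _ _) _; lra.
Qed.

Lemma ulimZ u l (c : C) : ulim u l -> ulim (fun n => c * u n) (c * l).
Proof.
move=> h e e0; have c0 : 0 < rnorm c + 1 by rewrite ltr_wpDl ?rnorm_ge0.
apply: filterS (h _ (divr_gt0 e0 c0)) => n /=; rewrite ltr_pdivlMr// => h1.
rewrite -mulrBr rnormM; apply: le_lt_trans h1; rewrite mulrC.
by rewrite ler_wpM2l ?rnorm_ge0// lerDl.
Qed.

Lemma ulim_ext u v l : u =1 v -> ulim u l -> ulim v l.
Proof. by move=> /funext ->. Qed.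

Lemma ulim_cst (l : C) : ulim (fun=> l) l.
Proof. by move=> e e0; apply: filterS (Uoo 0) => n _ /=; rewrite subrr rnorm0. Qed.

End UltrafilterLimits.

Lemma ultrafilter_nat : exists U : set_system nat,
  UltraFilter U /\ forall N, U [set n | (N <= n)%N].
Proof.
have [U [UU hU]] := @ultraFilterLemma nat \oo _.
by exists U; split=> // N; apply: hU; exists N.
Qed.

(** * Weak operator limits *)

Section WeakOperatorLimits.
Variables (R : realType) (H : completeNormedModType (CC R)).
Local Notation C := (CC R).
Implicit Types (S T L : bop H) (x y : H).
Variable dot : H -> H -> C.
Hypothesis hdot : inner_product dot.
Let hherm : hermitian_form dot := hdot.1.
Variable U : set_system nat.
Hypothesis UU : UltraFilter U.
Hypothesis Uoo : forall N, U [set n | (N <= n)%N].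
Let UF : ProperFilter U := @ultra_proper _ _ UU.

Definition wlim (T : nat -> bop H) L : Prop :=
  forall x y, ulim U (fun n => dot (T n x) y) (dot (L x) y).

Lemma wlim_exists (T : nat -> bop H) (M : R) : 0 <= M ->
  U [set n | opnorm (T n) <= M] -> exists L, wlim T L /\ opnorm L <= M.
Proof.
move=> M0 hM.
have bnd x y : U [set n | rnorm (dot (T n x) y) <= M * rnorm x * rnorm y].
  apply: filterS hM => n /= h; apply: le_trans (form_le hdot _ _ _) _.
  by rewrite !ler_wpM2r ?rnorm_ge0.
have ex x y : exists l, ulim U (fun n => dot (T n x) y) l.
  exact: ulim_exists (bnd x y).
pose B x y := sval (cid (ex x y)).
have hB x y : ulim U (fun n => dot (T n x) y) (B x y) := svalP (cid (ex x y)).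
have [|c x y z|c x y z|x y|L [hL Lb]] := @sesquilinear_operator _ _ dot hdot B M.
- exact: M0.
- apply: (ulim_unique UU (hB _ _)).
  apply: ulim_ext _ (ulimD UU (ulimZ UU c (hB x z)) (hB y z)).
  move=> n.
  by rewrite bop_linear (hermDl hherm) (hermZl hherm).
- apply: (ulim_unique UU (hB _ _)).
  apply: ulim_ext _ (ulimD UU (ulimZ UU c^* (hB z x)) (hB z y)).
  move=> n.
  by rewrite (hermDr hherm) (hermZr hherm).
- exact: ulim_le (hB x y) (bnd x y).
by exists L; split=> // x y; rewrite hL.
Qed.

Lemma wlim_le (T : nat -> bop H) L (b : R) : 0 <= b -> wlim T L ->
  U [set n | opnorm (T n) <= b] -> opnorm L <= b.
Proof.
move=> b0 hL hb; apply: (opnorm_le_form hdot) => // x y.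
apply: (ulim_le UU (hL x y)); apply: filterS hb => n /= h.
apply: le_trans (form_le hdot _ _ _) _.
by rewrite !ler_wpM2r ?rnorm_ge0.
Qed.

Lemma wlimD (S T : nat -> bop H) K L : wlim S K -> wlim T L ->
  wlim (fun n => S n + T n) (K + L).
Proof.
move=> hS hT x y; rewrite bop_addE (hermDl hherm).
apply: ulim_ext _ (ulimD UU (hS x y) (hT x y)).
by move=> n; rewrite bop_addE (hermDl hherm).
Qed.

Lemma wlimZ (T : nat -> bop H) L (c : C) : wlim T L ->
  wlim (fun n => c *: T n) (c *: L).
Proof.
move=> hT x y; rewrite bop_scaleE (hermZl hherm).
apply: ulim_ext _ (ulimZ UU c (hT x y)).
by move=> n; rewrite bop_scaleE (hermZl hherm).
Qed.

Lemma wlimB (S T : nat -> bop H) K L : wlim S K -> wlim T L ->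
  wlim (fun n => S n - T n) (K - L).
Proof.
move=> hS hT; have := wlimD hS (wlimZ (-1) hT).
by rewrite scaleN1r (_ : (fun n => _ + _) = (fun n => S n - T n))//;
  apply/funext => n; rewrite scaleN1r.
Qed.

Lemma wlim_cst L : wlim (fun=> L) L.
Proof. by move=> x y; exact: ulim_cst. Qed.

(** [s n] is a partial sum of the geometric series and [S] its weak limit. Consecutive sums become
    arbitrarily close, so the recursion passes to the limit; the adjoint of [T] carries [T] across
    it. *)
Lemma neumann T (q : R) : 0 <= q -> q < 1 -> opnorm T <= q ->
  exists S, (forall x, S (x - T x) = x) /\ (forall x, S x - T (S x) = x).
Proof.
move=> q0 q1 Tq; pose s := fix s n : bop H := if n is k.+1 then bid + bcomp T (s k) else 0.
have q10 : 0 < 1 - q by rewrite subr_gt0.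
have sS n : s n.+1 = bid + bcomp T (s n) by [].
have sSr n x : s n.+1 x = x + s n (T x).
  elim: n x => [|n IH] x; first by rewrite sS bop_addE bcompE bop_zeroE bop0.
  by rewrite sS bop_addE bcompE IH bopD sS bop_addE bcompE addrA.
have sb n : opnorm (s n) <= (1 - q)^-1.
  elim: n => [|n IH]; first by rewrite -rnorm_bop rnorm0 invr_ge0 ltW.
  rewrite sS; apply: le_trans (opnormD _ _) _.
  apply: le_trans (lerD (opnorm_id _) (opnorm_comp _ _)) _.
  apply: le_trans (lerD (lexx _) (ler_pM (opnorm_ge0 _) (opnorm_ge0 _) Tq IH)) _.
  rewrite (_ : 1 + q / (1 - q) = (1 - q)^-1)//; by field; rewrite gt_eqF.
have sd n x : rnorm (s n.+1 x - s n x) <= q ^+ n * rnorm x.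
  elim: n x => [|n IH] x; first by rewrite sS bop_addE bcompE bop_zeroE bop0 addr0 subr0 expr0 mul1r.
  rewrite sSr [s n.+1 x]sSr opprD addrACA subrr add0r.
  apply: le_trans (IH _) _; rewrite exprSr -mulrA ler_wpM2l ?exprn_ge0//.
  by apply: le_trans (opnormP _ _) _; rewrite ler_wpM2r ?rnorm_ge0.
have [S [hS _]] : exists S, wlim s S /\ opnorm S <= (1 - q)^-1.
  apply: wlim_exists; first by rewrite invr_ge0; exact: ltW.
  by apply: filterS (Uoo 0) => n _; exact: sb.
have qn (e : R) : 0 < e -> exists N, forall n, (N <= n)%N -> q ^+ n < e.
  move=> e0; have /cvgrPdist_lt/(_ _ e0)[N _ hN] : q ^+ n @[n --> \oo] --> 0.
    by apply: cvg_expr; rewrite ger0_norm.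
  by exists N => n /hN /=; rewrite sub0r normrN ger0_norm// exprn_ge0.
have diff0 x y : ulim U (fun n => dot (s n.+1 x - s n x) y) 0.
  move=> e e0; have K0 : 0 < rnorm x * rnorm y + 1.
    by rewrite ltr_wpDl// mulr_ge0 ?rnorm_ge0.
  have [N hN] := qn _ (divr_gt0 e0 K0).
  apply: filterS (Uoo N) => n /= /hN; rewrite ltr_pdivlMr// subr0 => h.
  apply: le_lt_trans (dot_CS hdot _ _) _.
  apply: le_lt_trans (ler_wpM2r (rnorm_ge0 _) (sd n x)) _.
  apply: le_lt_trans h; rewrite -mulrA ler_wpM2l ?exprn_ge0//.
  by rewrite lerDl.
have sS1 x y : ulim U (fun n => dot (s n.+1 x) y) (dot (S x) y).
  rewrite -[dot (S x) y]add0r; apply: ulim_ext _ (ulimD UU (diff0 x y) (hS x y)).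
  by move=> n; rewrite -(hermDl hherm) subrK.
have [Ta hTa] := adjoint_exists hdot T.
exists S; split=> x.
- rewrite bopB; apply/eqP; rewrite subr_eq; apply/eqP; apply: (dot_ext hdot) => y.
  apply: (ulim_unique UU (sS1 x y)); rewrite (hermDl hherm).
  apply: ulim_ext _ (ulimD UU (ulim_cst UU Uoo (dot x y)) (hS (T x) y)).
  by move=> n; rewrite sSr (hermDl hherm).
- apply/eqP; rewrite subr_eq; apply/eqP; apply: (dot_ext hdot) => y.
  apply: (ulim_unique UU (sS1 x y)); rewrite (hermDl hherm).
  rewrite (adjoint_sym hdot hTa).
  apply: ulim_ext _ (ulimD UU (ulim_cst UU Uoo (dot x y)) (hS x (Ta y))).
  by move=> n; rewrite sS bop_addE (hermDl hherm) bcompE (adjoint_sym hdot hTa).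
Qed.

(** For [t = c / m ^+ 2], expanding the square gives |x - t T x|^2 <= (1 - c^2 / m^2) |x|^2, so
    [neumann] inverts [t T]. Adding [c] in [m] ensures [m] positive and [r] nonnegative. *)
Lemma lax_milgram T (c : R) : 0 < c ->
  (forall x, c * rnorm x ^+ 2 <= complex.Re (dot (T x) x)) ->
  exists S, [/\ forall x, S (T x) = x, forall x, T (S x) = x & opnorm S <= c^-1].
Proof.
move=> c0 hT; pose m := opnorm T + c.
have m0 : 0 < m by rewrite ltr_wpDl// opnorm_ge0.
have Tm : opnorm T <= m by rewrite lerDl ltW.
have cm : c <= m by rewrite lerDr opnorm_ge0.
pose t := c / m ^+ 2; have t0 : 0 < t by rewrite divr_gt0// exprn_gt0.
pose r := 1 - c ^+ 2 / m ^+ 2.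
have r0 : 0 <= r.
  by rewrite subr_ge0 ler_pdivrMr ?exprn_gt0// mul1r lerXn2r ?nnegrE ?(ltW c0) ?(ltW m0).
have r1 : r < 1 by rewrite ltrBlDr ltrDl divr_gt0// exprn_gt0.
pose K := bid - (t%:C%C : C) *: T.
have Kb : opnorm K <= Num.sqrt r.
  apply: opnorm_le_mul => [|x]; first exact: sqrtr_ge0.
  rewrite -(@ler_pXn2r _ 2)// ?nnegrE ?mulr_ge0 ?rnorm_ge0 ?sqrtr_ge0//.
  rewrite exprMn sqr_sqrtr// -(dotxx hdot) /K bop_subE bop_scaleE.
  rewrite (herm_sqrD hherm) (dotxx hdot) (hermNr hherm) (hermNl hherm) (hermNr hherm).
  rewrite opprK (hermZr hherm) (hermZl hherm) (hermZr hherm).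
  have ct : (t%:C%C)^* = t%:C%C :> C by rewrite -[LHS]/(conjc _) conjc_real.
  have Rt (z : C) : complex.Re (t%:C%C * z : C) = t * complex.Re z.
    by rewrite ReM /= mul0r subr0.
  rewrite !ct raddfN /= !Rt (dotxx hdot).
  have h1 : complex.Re (dot x (T x)) = complex.Re (dot (T x) x).
    by rewrite (hermC hherm) Re_conj.
  have h2 : rnorm (T x) ^+ 2 <= m ^+ 2 * rnorm x ^+ 2.
    rewrite -exprMn lerXn2r ?nnegrE ?mulr_ge0 ?rnorm_ge0 ?(ltW m0)//.
    by apply: le_trans (opnormP _ _) _; rewrite ler_wpM2r ?rnorm_ge0.
  have h3 : t * (t * rnorm (T x) ^+ 2) <= t * (t * (m ^+ 2 * rnorm x ^+ 2)).
    by rewrite !ler_pM2l.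
  have h4 : t * (c * rnorm x ^+ 2) <= t * complex.Re (dot (T x) x) by rewrite ler_pM2l.
  have e1 : t * (t * (m ^+ 2 * rnorm x ^+ 2)) = c ^+ 2 / m ^+ 2 * rnorm x ^+ 2.
    by rewrite /t; field; rewrite gt_eqF.
  have e2 : t * (c * rnorm x ^+ 2) = c ^+ 2 / m ^+ 2 * rnorm x ^+ 2.
    by rewrite /t; field; rewrite gt_eqF.
  have e3 : r * rnorm x ^+ 2 = rnorm x ^+ 2 - c ^+ 2 / m ^+ 2 * rnorm x ^+ 2.
    by rewrite /r mulrBl mul1r.
  move: h3 h4; rewrite h1 e1 e2 e3; lra.
have sr1 : Num.sqrt r < 1 by rewrite -[ltRHS]sqrtr1 ltr_sqrt.
have [S [hS1 hS2]] := neumann (sqrtr_ge0 r) sr1 Kb.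
have e x : x - K x = (t%:C%C : C) *: T x by rewrite /K bop_subE bop_scaleE opprB addrC subrK.
exists ((t%:C%C : C) *: S); split=> [x|x|].
- by rewrite bop_scaleE -bopZ -e hS1.
- by rewrite bop_scaleE bopZ -e hS2.
- apply: opnorm_le_mul => [|x]; first by rewrite invr_ge0 ltW.
  set y := _ x; have Ty : T y = x by rewrite /y bop_scaleE bopZ -e hS2.
  have [->|y0] := eqVneq y 0; first by rewrite rnorm0 mulr_ge0 ?invr_ge0 ?rnorm_ge0// ltW.
  have yp : 0 < rnorm y by rewrite rnorm_gt0.
  rewrite ler_pdivlMl// -(ler_pM2r yp) -mulrA -expr2; apply: le_trans (hT y) _.
  rewrite Ty; apply: le_trans (dot_CS hdot _ _).
  exact: le_trans (ler_norm _) (Re_le_rnorm _).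
Qed.

(* The hypothesis bounds second-order differences only through norms of      *)
(* finite linear combinations of values of [F], so it passes to weak limits. *)
Lemma second_difference_has_diff (V : normedModType C) (F : V -> bop H) (p : V)
    (d k M : R) : 0 < d -> 0 <= k ->
  (forall u, rnorm u <= d -> opnorm (F (p + u)) <= M) ->
  (forall (c : C) u v, rnorm (c *: u + v) <= d -> rnorm u <= d -> rnorm v <= d ->
    opnorm (F (p + (c *: u + v)) - F p - c *: (F (p + u) - F p) - (F (p + v) - F p)) <=
    k * (rnorm (c *: u + v) ^+ 2 + rnorm c * rnorm u ^+ 2 + rnorm v ^+ 2)) ->
  exists D, has_diff F p D.
Proof.
move=> d0 k0 hM hF.
pose E (c : C) u v :=
  F (p + (c *: u + v)) - F p - c *: (F (p + u) - F p) - (F (p + v) - F p).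
pose a (n : nat) : C := n.+1%:R.
have an n : rnorm (a n) = n.+1%:R by rewrite rnorm_nat.
have a0 n : a n != 0 by rewrite pnatr_eq0.
have nai n (w : V) : rnorm ((a n)^-1 *: w) = rnorm w / n.+1%:R.
  by rewrite rnormZ rnormV an mulrC.
have np n : (0 : R) < n.+1%:R by [].
pose T w n := a n *: (F (p + (a n)^-1 *: w) - F p).
have M0 : 0 <= M by apply: le_trans (opnorm_ge0 _) (hM 0 _); rewrite rnorm0 ltW.
have Fb u : rnorm u <= d -> opnorm (F (p + u) - F p) <= 2 * M.
  move=> ud; rewrite -rnorm_bop; apply: le_trans (rnormB _ _) _; rewrite !rnorm_bop.
  have := hM u ud; have := hM 0; rewrite addr0 rnorm0 => /(_ (ltW d0)); lra.
have near w n : rnorm w <= d -> opnorm (F (p + w) - F p - T w n) <= 2 * k * rnorm w ^+ 2.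
  move=> wd; have wn : rnorm w / n.+1%:R <= rnorm w.
    by rewrite ler_pdivrMr// ler_peMr ?rnorm_ge0// ler1n.
  have := hF (a n) ((a n)^-1 *: w) 0.
  rewrite scalerA mulfV// scale1r !addr0 subrr subr0 rnorm0 nai an => /(_ wd _ _)h.
  apply: le_trans (h _ _) _; [exact: le_trans wn wd|exact: ltW|].
  rewrite expr0n addr0 (_ : 2 * k * rnorm w ^+ 2 = k * (rnorm w ^+ 2 + rnorm w ^+ 2)); last by ring.
  rewrite ler_wpM2l// lerD2l.
  rewrite (_ : _ * _ ^+ 2 = rnorm w ^+ 2 * n.+1%:R^-1); last by move: (np n); move: (n.+1%:R) => r r0; field; rewrite gt_eqF.
  by rewrite ler_piMr ?sqr_ge0// invf_le1// ler1n.
have small (w : V) : exists N, forall n, (N <= n)%N -> rnorm ((a n)^-1 *: w) <= d.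
  exists (Num.bound (rnorm w / d)) => n Nn; rewrite nai ler_pdivrMr// mulrC -ler_pdivrMr//.
  apply: le_trans (ltW (archi_boundP _)) _; first by rewrite divr_ge0 ?rnorm_ge0// ltW.
  by rewrite ler_nat; exact: leqW.
have Tb w : exists K, 0 <= K /\ U [set n | opnorm (T w n) <= K].
  have [N hN] := small w; set w0 := (a N)^-1 *: w.
  have w0d : rnorm w0 <= d := hN N (leqnn _).
  exists (N.+1%:R * (2 * M + 2 * k * d ^+ 2)); split.
    by apply: mulr_ge0 => //; apply: addr_ge0; apply: mulr_ge0; rewrite ?sqr_ge0 ?mulr_ge0.
  apply: filterS (Uoo N) => n /= Nn; set u := (a n)^-1 *: w.
  have ud : rnorm u <= d := hN n Nn.
  (* Rescales [u] to the fixed vector [w0] of the ball, so the second-difference bound compares the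
     quotient with one fixed increment of [F]. *)
  pose c := a n / a N.
  have cu : c *: u = w0 by rewrite scalerA /c mulrAC mulfV// mul1r.
  have -> : T w n = a N *: (c *: (F (p + u) - F p)) by rewrite scalerA /c mulrCA mulfV// mulr1.
  rewrite opnormZ an ler_pM2l//.
  have := hF c u 0; rewrite addr0 cu rnorm0 addr0 subrr subr0 => /(_ w0d ud (ltW d0)) h.
  have cu2 : rnorm c * rnorm u ^+ 2 <= d ^+ 2.
    rewrite expr2 mulrA -rnormZ cu expr2.
    by rewrite ler_pM ?rnorm_ge0.
  have w02 : rnorm w0 ^+ 2 <= d ^+ 2 by rewrite lerXn2r ?nnegrE ?rnorm_ge0 ?(ltW d0).
  have h1 : k * (rnorm w0 ^+ 2 + rnorm c * rnorm u ^+ 2 + 0 ^+ 2) <= 2 * k * d ^+ 2.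
    have : k * (rnorm w0 ^+ 2 + rnorm c * rnorm u ^+ 2) <= k * (d ^+ 2 + d ^+ 2).
      by rewrite ler_wpM2l// lerD.
    rewrite expr0n addr0; lra.
  rewrite -rnorm_bop.
  have -> : c *: (F (p + u) - F p) = (F (p + w0) - F p) -
    (F (p + w0) - F p - c *: (F (p + u) - F p)) by rewrite subKr.
  apply: le_trans (rnormB _ _) _; rewrite !rnorm_bop; apply: lerD; first exact: Fb.
  exact: le_trans h h1.
have /boolp.choice[D hD] : forall w, exists L, wlim (T w) L.
  by move=> w; have [K [K0 hK]] := Tb w; have [L [hL _]] := wlim_exists K0 hK; exists L.
(* The linearity defect of the quotients is [a n] times a second difference of step [(a n)^-1],
   hence of order 1/n. *)
have lD : linear D.
  move=> c u v; apply/eqP; rewrite -subr_eq0 opprD addrA; apply/eqP.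
  apply: rnorm_le_small => e e0; rewrite rnorm_bop.
  have hl := wlimB (wlimB (hD (c *: u + v)) (wlimZ c (hD u))) (hD v).
  apply: (wlim_le (ltW e0) hl).
  pose s := rnorm (c *: u + v) ^+ 2 + rnorm c * rnorm u ^+ 2 + rnorm v ^+ 2.
  have s0 : 0 <= s by rewrite !addr_ge0 ?mulr_ge0 ?sqr_ge0 ?rnorm_ge0.
  have [N1 hN1] := small u; have [N2 hN2] := small v; have [N3 hN3] := small (c *: u + v).
  pose N4 := Num.bound (k * s / e).
  apply: filterS (filterI (filterI (Uoo N1) (Uoo N2)) (filterI (Uoo N3) (Uoo N4))).
  move=> n [[/= /hN1 n1 /hN2 n2] [/hN3 n3 n4]].
  have eq : (a n)^-1 *: (c *: u + v) = c *: ((a n)^-1 *: u) + (a n)^-1 *: v.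
    by rewrite scalerDr !scalerA (mulrC c).
  have -> : T (c *: u + v) n - c *: T u n - T v n = a n *: E c ((a n)^-1 *: u) ((a n)^-1 *: v).
    by rewrite /T /E eq !scalerBr !scalerA (mulrC c (a n)).
  rewrite -rnorm_bop rnormZ an; rewrite eq in n3.
  have := hF c _ _ n3 n1 n2; rewrite -/(E c _ _) -rnorm_bop => h.
  apply: le_trans (ler_wpM2l (ltW (np n)) h) _.
  have fl (m x y z t : R) : m != 0 ->
    m * (k * (x / m ^+ 2 + t * (y / m ^+ 2) + z / m ^+ 2)) = k * (x + t * y + z) / m.
    by move=> ?; field.
  rewrite -eq !nai !expr_div_n fl ?pnatr_eq0// -/s.
  rewrite ler_pdivrMr// [leRHS]mulrC -ler_pdivrMr//.
  apply: le_trans (ltW (archi_boundP _)) _; first by rewrite divr_ge0 ?mulr_ge0// ltW.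
  by rewrite ler_nat; exact: leqW.
have rD w : rnorm w <= d -> opnorm (F (p + w) - F p - D w) <= 2 * k * rnorm w ^+ 2.
  move=> wd; apply: (wlim_le _ (wlimB (wlim_cst (F (p + w) - F p)) (hD w))).
    by apply: mulr_ge0; rewrite ?sqr_ge0 ?mulr_ge0.
  by apply: filterS (Uoo 0) => n _; exact: near.
exists D; split => //.
- exists ((2 * M + 2 * k * d ^+ 2) / d) => w.
  have D0 : D 0 = 0 by have := lD (-1) 0 0; rewrite scaler0 addr0 scaleN1r addNr.
  have DZ (c : C) u : D (c *: u) = c *: D u by have := lD c u 0; rewrite !addr0 D0 addr0.
  have [->|w0] := eqVneq w 0; first by rewrite D0 !rnorm0 mulr0.
  have wp : 0 < rnorm w by rewrite rnorm_gt0.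
  pose s : R := d / rnorm w; have s0 : 0 < s by rewrite divr_gt0.
  have sw : rnorm (s%:C%C *: w : V) = d.
    by rewrite rnormZ rnormR gtr0_norm// divfK// gt_eqF.
  have : rnorm (D (s%:C%C *: w)) <= 2 * M + 2 * k * d ^+ 2.
    rewrite -[D _](subKr (F (p + s%:C%C *: w) - F p)).
    apply: le_trans (rnormB _ _) _; rewrite !rnorm_bop; apply: lerD.
      by apply: Fb; rewrite sw.
    by apply: le_trans (rD _ _) _; rewrite sw.
  rewrite DZ rnormZ rnormR gtr0_norm// -ler_pdivlMl// => /le_trans; apply.
  by rewrite /s invf_div mulrC mulrA mulrAC.
- move=> e e0; exists (Num.min d (e / (2 * k + 1))).
    by rewrite lt_min d0 divr_gt0// ltr_wpDl// mulr_ge0.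
  move=> w; rewrite lt_min => /andP[wd we]; rewrite rnorm_bop.
  apply: le_trans (rD w (ltW wd)) _; rewrite expr2 mulrA ler_wpM2r ?rnorm_ge0//.
  have : rnorm w * (2 * k + 1) < e by rewrite -ltr_pdivlMr// ltr_wpDl// mulr_ge0.
  have := rnorm_ge0 w; lra.
Qed.

End WeakOperatorLimits.

(** * Operator Moebius transforms *)

Section OperatorMoebius.
Variables (R : realType) (H : completeNormedModType (CC R)).
Local Notation C := (CC R).
Implicit Types (S T K : bop H) (x y v : H).
Variable dot : H -> H -> C.
Hypothesis hdot : inner_product dot.
Let hherm : hermitian_form dot := hdot.1.

Lemma coercive_inverse T (c : R) : 0 < c ->
  (forall x, c * rnorm x ^+ 2 <= complex.Re (dot (T x) x)) ->
  exists S, [/\ forall x, S (T x) = x, forall x, T (S x) = x & opnorm S <= c^-1].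
Proof.
have [U [UU Uoo]] := ultrafilter_nat.
exact: (lax_milgram hdot UU Uoo).
Qed.

Variables (A As : bop H) (r : R).
Hypothesis adjA : forall x y, dot (As x) y = dot x (A y).
Hypothesis r0 : 0 <= r.
Hypothesis r1 : r < 1.
Hypothesis Ar : opnorm A <= r.

Let Asr : opnorm As <= r := le_trans (opnorm_adjoint hdot adjA) Ar.

Let adjA' : forall x y, dot (A x) y = dot x (As y) := adjoint_sym hdot adjA.

(** [1 - B Bs] is coercive with constant [1 - r ^+ 2], which bounds its inverse [P]; the lower bound
    comes from <P x, x> = |P x|^2 - |Bs P x|^2. Applied with [B] equal to [A] and to its adjoint. *)
Lemma defect_inverse (B Bs : bop H) :
  (forall x y, dot (Bs x) y = dot x (B y)) -> opnorm B <= r ->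
  exists P : bop H, [/\ forall x, P (x - B (Bs x)) = x, forall x, P x - B (Bs (P x)) = x,
    forall x y, dot (P x) y = dot x (P y),
    forall x, rnorm x ^+ 2 <= complex.Re (dot (P x) x) &
    forall x, (1 - r ^+ 2) * complex.Re (dot (P x) x) <= rnorm x ^+ 2].
Proof.
move=> adjB Br; have adjB' := adjoint_sym hdot adjB.
have Bsr : opnorm Bs <= r := le_trans (opnorm_adjoint hdot adjB) Br.
have r2 : 0 < 1 - r ^+ 2 by rewrite subr_gt0 expr_lt1.
have Bc (T : bop H) x : opnorm T <= r -> rnorm (T x) ^+ 2 <= r ^+ 2 * rnorm x ^+ 2.
  move=> Tr; rewrite -exprMn lerXn2r ?nnegrE ?mulr_ge0 ?rnorm_ge0//.
  by apply: le_trans (opnormP _ _) _; rewrite ler_wpM2r ?rnorm_ge0.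
have [|P [P1 P2 Pb]] := @coercive_inverse (bid - bcomp B Bs) _ r2.
  move=> x; rewrite bop_subE bcompE (hermBl hherm) adjB' ReB !(dotxx hdot).
  by have := Bc Bs x Bsr; lra.
exists P; have Pl x : P (x - B (Bs x)) = x by rewrite -[RHS]P1.
have Pr x : P x - B (Bs (P x)) = x by rewrite -[RHS]P2.
have Psa x y : dot (P x) y = dot x (P y).
  rewrite -{1}(Pr y) -{2}(Pr x) (hermBl hherm) (hermBr hherm).
  by rewrite adjB' adjB.
have Pn x : complex.Re (dot (P x) x) = rnorm (P x) ^+ 2 - rnorm (Bs (P x)) ^+ 2.
  by rewrite -{2}(Pr x) (hermBr hherm) -adjB ReB !(dotxx hdot).
split=> // x.
- rewrite Pn -[in leLHS](Pr x) -(dotxx hdot) (herm_sqrD hherm) (hermNr hherm).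
  rewrite (hermNl hherm) (hermNr hherm) opprK -adjB raddfN /= !(dotxx hdot).
  have := Bc B (Bs (P x)) Br; have := sqr_ge0 (rnorm (Bs (P x))).
  have : r ^+ 2 <= 1 by apply: exprn_ile1 => //; exact: ltW.
  move=> h1 h2 h3.
  have : r ^+ 2 * rnorm (Bs (P x)) ^+ 2 <= rnorm (Bs (P x)) ^+ 2 by rewrite ler_piMl.
  move: (rnorm _ ^+ 2) (rnorm (Bs (P x)) ^+ 2) (rnorm (P x) ^+ 2) h3 => *; lra.
- have h1 : complex.Re (dot (P x) x) <= rnorm (P x) * rnorm x.
    exact: le_trans (le_trans (ler_norm _) (Re_le_rnorm _)) (dot_CS hdot _ _).
  have h2 : (1 - r ^+ 2) * rnorm (P x) <= rnorm x.
    by rewrite -ler_pdivlMl//; apply: le_trans (opnormP _ _) _; rewrite ler_wpM2r ?rnorm_ge0.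
  apply: le_trans (ler_wpM2l (ltW r2) h1) _; rewrite mulrA expr2.
  by rewrite ler_wpM2r ?rnorm_ge0.
Qed.

Variables P Q : bop H.
Hypothesis Pl : forall x, P (x - A (As x)) = x.
Hypothesis Pr : forall x, P x - A (As (P x)) = x.
Hypothesis Psa : forall x y, dot (P x) y = dot x (P y).
Hypothesis Plb : forall x, rnorm x ^+ 2 <= complex.Re (dot (P x) x).
Hypothesis Pub : forall x, (1 - r ^+ 2) * complex.Re (dot (P x) x) <= rnorm x ^+ 2.
Hypothesis Ql : forall x, Q (x - As (A x)) = x.
Hypothesis Qr : forall x, Q x - As (A (Q x)) = x.

Lemma defect_intertwine x : Q (As x) = As (P x).
Proof. by rewrite -{1}(Pr x) bopB Ql. Qed.

Lemma defect_intertwine' x : P (A x) = A (Q x).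
Proof. by rewrite -{1}(Qr x) bopB Pl. Qed.

(* [(y, v) |-> (y - As v, v - A y)] is isometric from the indefinite form      *)
(* [|y|^2 - |v|^2] to its version weighted by [Q] and [P].  Weights by         *)
(* inverses replace the usual square roots of the defect operators.            *)
Lemma defect_identity y v :
  complex.Re (dot (Q (y - As v)) (y - As v)) -
  complex.Re (dot (P (v - A y)) (v - A y)) = rnorm y ^+ 2 - rnorm v ^+ 2.
Proof.
rewrite bopB [P _]bopB defect_intertwine defect_intertwine' -ReB.
rewrite -!(dotxx hdot) -ReB.
have -> : dot y y = dot (Q y - As (A (Q y))) y by rewrite Qr.
have -> : dot v v = dot (P v - A (As (P v))) v by rewrite Pr.
congr complex.Re; rewrite !(hermBl hherm) !(hermBr hherm) !(adjA, adjA'); ring.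
Qed.

(* [K = (T - A) (1 - As T)^-1], in a form that can be solved for [T] as well.  *)
Definition moebius T K : Prop := forall y, K (y - As (T y)) = T y - A y.

Lemma defect_form_CS x y :
  rnorm (dot (P x) y) ^+ 2 <= complex.Re (dot (P x) x) * complex.Re (dot (P y) y).
Proof.
apply: (@herm_CauchySchwarz R H (fun x y => dot (P x) y)) => [|z].
  split=> [c u v w|u v]; first by rewrite bop_linear (hermDl hherm) (hermZl hherm).
  by rewrite (hermC hherm) Psa.
exact: le_trans (sqr_ge0 _) (Plb z).
Qed.

(** [S] inverts [1 - As T], coercive because [As T] has norm at most [r]. The weighted contractivity
    is [defect_identity] at [S x] and [T (S x)]. *)
Lemma moebius_exists T : opnorm T <= 1 ->
  exists K S, [/\ moebius T K, forall x, S x - As (T (S x)) = x,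
    opnorm K <= 2 / (1 - r) &
    forall x, complex.Re (dot (P (K x)) (K x)) <= complex.Re (dot (Q x) x)].
Proof.
move=> T1; have r10 : 0 < 1 - r by rewrite subr_gt0.
have [|S [S1 S2 Sb]] := @coercive_inverse (bid - bcomp As T) _ r10.
  move=> x; rewrite bop_subE bcompE (hermBl hherm) ReB (dotxx hdot).
  have h : complex.Re (dot (As (T x)) x) <= rnorm (As (T x)) * rnorm x.
    exact: le_trans (le_trans (ler_norm _) (Re_le_rnorm _)) (dot_CS hdot _ _).
  have h2 : rnorm (As (T x)) <= r * rnorm x.
    apply: le_trans (opnormP _ _) _; apply: ler_pM; rewrite ?opnorm_ge0 ?rnorm_ge0//.
    apply: le_trans (opnormP _ _) _.
    by rewrite -[leRHS]mul1r ler_wpM2r ?rnorm_ge0.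
  have := ler_wpM2r (rnorm_ge0 x) h2; rewrite -mulrA -expr2; lra.
have S2' x : S x - As (T (S x)) = x by rewrite -[RHS]S2.
exists (bcomp (T - A) S), S; split=> //.
- move=> y; rewrite bcompE; have -> : S (y - As (T y)) = y by rewrite -[RHS]S1.
  by rewrite bop_subE.
- apply: le_trans (opnorm_comp _ _) _; apply: ler_pM; rewrite ?opnorm_ge0//.
  rewrite -rnorm_bop; apply: le_trans (rnormB _ _) _; rewrite !rnorm_bop.
  by apply: le_trans (lerD T1 (le_trans Ar (ltW r1))) _.
- move=> x; rewrite bcompE bop_subE.
  have := defect_identity (S x) (T (S x)); rewrite S2'.
  have : rnorm (T (S x)) ^+ 2 <= rnorm (S x) ^+ 2.
    rewrite lerXn2r ?nnegrE ?rnorm_ge0//; apply: le_trans (opnormP _ _) _.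
    by rewrite -[leRHS]mul1r ler_wpM2r ?rnorm_ge0.
  lra.
Qed.

(** An exact difference formula, with factor 1 + K1 As. It gives holomorphy in both directions of
    the transform and the uniqueness of [T] once this factor has a left inverse. *)
Lemma moebius_diff T1 K1 T2 K2 y : moebius T1 K1 -> moebius T2 K2 ->
  K1 (y - As (T2 y)) - K2 (y - As (T2 y)) =
  (T1 y - T2 y) + K1 (As (T1 y - T2 y)).
Proof.
move=> m1 m2.
have -> : K1 (y - As (T2 y)) = (T1 y - A y) + K1 (As (T1 y - T2 y)).
  by rewrite -m1 -bopD; congr (K1 _); rewrite bopB addrA subrK.
by rewrite m2 [LHS]addrAC; congr (_ + _); rewrite opprB addrA subrK.
Qed.

(** [T] solves (1 + K As) T = K + A. Multiplying by [P] makes the left factor coercive: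
    Cauchy-Schwarz for the form of [P] and <Q As v, As v> = <P v, v> - |v|^2 <= r^2 <P v, v> bound
    the cross term by r <P v, v>. The last conclusion says that P - T As P is a left inverse of 1 +
    K As. *)
Lemma moebius_inverse K :
  (forall x, complex.Re (dot (P (K x)) (K x)) <= complex.Re (dot (Q x) x)) ->
  exists T, [/\ moebius T K, opnorm T <= 1 &
    forall x, P (x + K (As x)) - T (As (P (x + K (As x)))) = x].
Proof.
move=> hK; have r10 : 0 < 1 - r by rewrite subr_gt0.
have Pge0 x : 0 <= complex.Re (dot (P x) x) := le_trans (sqr_ge0 _) (Plb x).
have [|N [N1 N2 _]] := @coercive_inverse (bcomp P (bid + bcomp K As)) _ r10.
  move=> v; rewrite bcompE bop_addE bcompE bopD (hermDl hherm) raddfD /=.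
  set p := complex.Re (dot (P v) v); have p0 : 0 <= p := Pge0 v.
  have h1 : rnorm (dot (P (K (As v))) v) <= r * p.
    rewrite -(@ler_pXn2r _ 2)// ?nnegrE ?rnorm_ge0 ?mulr_ge0//.
    apply: le_trans (defect_form_CS _ _) _; rewrite -/p.
    apply: le_trans (ler_wpM2r p0 (hK (As v))) _.
    have -> : complex.Re (dot (Q (As v)) (As v)) = p - rnorm v ^+ 2.
      rewrite defect_intertwine -adjA' -(dotxx hdot) -ReB -(hermBl hherm).
      by rewrite -{4}(Pr v) subKr.
    rewrite exprMn [in leRHS]expr2 mulrA ler_wpM2r//.
    have := Pub v; rewrite -/p; lra.
  have := le_trans (ler_norm _) (Re_le_rnorm (- dot (P (K (As v))) v)).
  rewrite rnormN raddfN /= => h2; have := Plb v; rewrite -/p => h3.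
  have : (1 - r) * rnorm v ^+ 2 <= (1 - r) * p by rewrite ler_pM2l.
  lra.
have Pinj u v : P u = P v -> u = v.
  by move=> e; rewrite -(Pr u) -(Pr v) e.
pose T := bcomp N (bcomp P (K + A)).
have mT : moebius T K.
  move=> y; rewrite bopB; apply/eqP; rewrite subr_eq addrAC eq_sym subr_eq; apply/eqP.
  have := N2 (P (K y + A y)); rewrite bcompE bop_addE bcompE => /Pinj.
  by rewrite /T !bcompE bop_addE.
have T1 : opnorm T <= 1.
  apply: opnorm_le_mul => // y; rewrite mul1r -(@ler_pXn2r _ 2)// ?nnegrE ?rnorm_ge0//.
  have := defect_identity y (T y); rewrite -(mT y); have := hK (y - As (T y)); lra.
exists T; split=> // x; set w := x + _.
have Nw : N (P w) = x by rewrite -[RHS]N1.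
set u := P w - _.
have hu : u + K (As u) = w.
  by rewrite /u bopB mT addrA subrK; exact: Pr.
by rewrite -Nw -hu -[LHS]N1.
Qed.

End OperatorMoebius.

(** * Operator-valued holomorphic maps *)

Section OperatorValuedMaps.
Variables (R : realType) (H : completeNormedModType (CC R)).
Local Notation C := (CC R).
Implicit Types (x y : H).
Variable dot : H -> H -> C.
Hypothesis hdot : inner_product dot.
Let hherm : hermitian_form dot := hdot.1.
Variable V : normedModType C.
Implicit Types (p q u v : V) (F : V -> bop H).

Lemma has_diff_linear (W W' : normedModType C) (f : V -> W) (L : W -> W') (m : R) p D :
  linear L -> (forall w, rnorm (L w) <= m * rnorm w) ->
  has_diff f p D -> has_diff (fun z => L (f z)) p (L \o D).
Proof.
move=> lL bL [lD [k bD] oD].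
have LB a b : L (a - b) = L a - L b.
  by rewrite addrC -scaleN1r lL scaleN1r addrC.
have bL' w : rnorm (L w) <= (`|m| + 1) * rnorm w.
  apply: le_trans (bL w) _; rewrite ler_wpM2r ?rnorm_ge0//.
  by apply: le_trans (ler_norm m) _; rewrite lerDl.
have m0 : 0 < `|m| + 1 by rewrite ltr_wpDl.
split.
- by move=> c u v /=; rewrite lD lL.
- exists ((`|m| + 1) * k) => h /=; apply: le_trans (bL' _) _.
  by rewrite -mulrA ler_wpM2l// ltW.
- move=> e e0; have [d d0 hd] := oD _ (divr_gt0 e0 m0).
  exists d => // h /hd h1; rewrite -!LB; apply: le_trans (bL' _) _.
  by rewrite -ler_pdivlMl// mulrA [_^-1 * e]mulrC.
Qed.

(** The derivative is L(p) DG S. The variation of [L] is again one of [F], so inserting the first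
    identity into the second makes the remaining error quadratic in the increment of [G]; a local
    bound on [L] suffices. *)
Lemma has_diff_transfer (F G L : V -> bop H) (B S : bop H) p (m d : R) DG :
  0 < d -> has_diff G p DG ->
  (forall h, rnorm h < d -> forall x,
     F (p + h) x - F p x = L (p + h) (G (p + h) (S x) - G p (S x))) ->
  (forall h, rnorm h < d -> forall x,
     L (p + h) x - L p x = F (p + h) (B x) - F p (B x)) ->
  (forall h, rnorm h < d -> opnorm (L (p + h)) <= m) ->
  exists D, has_diff F p D.
Proof.
move=> d0 [lD [k bD] oD] hF hL hm.
exists (fun h => bcomp (bcomp (L p) (DG h)) S); split.
- move=> c u v; apply: bop_ext => x; rewrite bop_addE bop_scaleE !bcompE lD.
  by rewrite bop_addE bop_scaleE bop_linear.
- exists (opnorm (L p) * k * opnorm S) => h; rewrite rnorm_bop.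
  apply: le_trans (opnorm_comp _ _) _; rewrite mulrAC ler_wpM2r ?opnorm_ge0//.
  apply: le_trans (opnorm_comp _ _) _; rewrite -mulrA ler_wpM2l ?opnorm_ge0//.
  by rewrite -rnorm_bop.
have [d1 d10 hd1] := oD 1 ltr01.
have k1 : 0 < `|k| + 1 by rewrite ltr_wpDl.
have m0 : 0 <= m.
  by apply: le_trans (opnorm_ge0 _) (hm 0 _); rewrite rnorm0.
have Glip h : rnorm h < d1 -> opnorm (G (p + h) - G p) <= (`|k| + 1) * rnorm h.
  move=> /hd1 h1; rewrite -rnorm_bop -[_ - _](subrK (DG h)).
  apply: le_trans (rnormD _ _) _; rewrite addrC mulrDl; apply: lerD => //.
  by apply: le_trans (bD h) _; rewrite ler_wpM2r ?rnorm_ge0// ler_norm.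
pose s := opnorm S; pose b := opnorm B.
have s0 : 0 <= s := opnorm_ge0 _; have b0 : 0 <= b := opnorm_ge0 _.
pose K1 := opnorm (L p) * s; have K10 : 0 <= K1 by rewrite mulr_ge0 ?opnorm_ge0.
pose K2 := m * b * s ^+ 2 * (`|k| + 1) ^+ 2.
have K20 : 0 <= K2 by rewrite !mulr_ge0 ?sqr_ge0.
move=> e e0; have e1 : 0 < e / (2 * (K1 + 1)) by rewrite divr_gt0// mulr_gt0// ltr_wpDl.
have [d2 d20 hd2] := oD _ e1.
exists (Num.min (Num.min d d1) (Num.min d2 (e / (2 * (K2 + 1))))).
  by rewrite !lt_min d0 d10 d20 divr_gt0// mulr_gt0// ltr_wpDl.
move=> h; rewrite !lt_min => /andP[/andP[hd' hd1'] /andP[/hd2 g1 g2]].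
rewrite rnorm_bop in g1 *; apply: opnorm_le_mul => [|x].
  by rewrite mulr_ge0 ?rnorm_ge0// ltW.
set dG := G (p + h) - G p in g1.
have dGE y : dG y = G (p + h) y - G p y by [].
have FE y : F (p + h) y - F p y = L (p + h) (dG (S y)) by rewrite hF.
have -> : (F (p + h) - F p - bcomp (bcomp (L p) (DG h)) S) x =
    L p ((dG - DG h) (S x)) + L (p + h) (dG (S (B (dG (S x))))).
  have -> : L p ((dG - DG h) (S x)) = L p (dG (S x)) - L p (DG h (S x)).
    by rewrite bop_subE bopB.
  by rewrite -FE -hL// [RHS]addrC subrKA -FE.
apply: le_trans (rnormD _ _) _.
have t1 : rnorm (L p ((dG - DG h) (S x))) <= e / 2 * rnorm h * rnorm x.
  apply: le_trans (opnormP _ _) _.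
  apply: le_trans (ler_wpM2l (opnorm_ge0 _) (opnormP _ _)) _.
  apply: le_trans (ler_wpM2l (opnorm_ge0 _) (ler_pM (opnorm_ge0 _) (rnorm_ge0 _) g1 (opnormP S x))) _.
  have fl (o t a y : R) : o * t + 1 != 0 ->
    o * (e / (2 * (o * t + 1)) * a * (t * y)) = e / 2 * a * y * (o * t / (o * t + 1)).
    by move=> ?; field.
  rewrite fl -/K1; last by rewrite gt_eqF// ltr_wpDl.
  rewrite ler_piMr ?mulr_ge0 ?rnorm_ge0 ?divr_ge0 ?(ltW e0)//.
  by rewrite ler_pdivrMr ?mul1r ?lerDl// ltr_wpDl.
have t2 : rnorm (L (p + h) (dG (S (B (dG (S x)))))) <= K2 * rnorm h ^+ 2 * rnorm x.
  have gl := Glip _ hd1'; rewrite -/dG in gl.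
  have st y : rnorm (dG (S y)) <= (`|k| + 1) * rnorm h * s * rnorm y.
    apply: le_trans (opnormP _ _) _; rewrite -[leRHS]mulrA.
    by apply: ler_pM; rewrite ?opnorm_ge0 ?rnorm_ge0// opnormP.
  apply: le_trans (opnormP _ _) _.
  apply: le_trans (ler_pM (opnorm_ge0 _) (rnorm_ge0 _) (hm _ hd') (st _)) _.
  have c0 : 0 <= (`|k| + 1) * rnorm h * s by rewrite !mulr_ge0 ?rnorm_ge0// ltW.
  have : rnorm (B (dG (S x))) <= b * ((`|k| + 1) * rnorm h * s * rnorm x).
    by apply: le_trans (opnormP _ _) _; rewrite ler_wpM2l.
  move=> /(ler_wpM2l c0)/(ler_wpM2l m0)/le_trans; apply.
  by rewrite le_eqVlt; apply/orP; left; apply/eqP; rewrite /K2; ring.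
have t3 : K2 * rnorm h ^+ 2 <= e / 2 * rnorm h.
  rewrite expr2 mulrA ler_wpM2r ?rnorm_ge0//.
  move: g2; rewrite ltr_pdivlMr; last by rewrite mulr_gt0// ltr_wpDl.
  have := rnorm_ge0 h; lra.
have := ler_wpM2r (rnorm_ge0 x) t3.
move: t1 t2; lra.
Qed.

(** The scalar estimate is linear in the bound on the function, here M |x| |y| for the coefficient
    at x and y, so it is an estimate of forms. *)
Lemma weak_second_difference F p (rho M : R) (c : C) u v :
  0 < rho -> 0 <= M ->
  (forall x y q, rnorm (q - p) < rho -> exists D, has_diff (fun q => dot (F q x) y) q D) ->
  (forall q, rnorm (q - p) < rho -> opnorm (F q) <= M) ->
  rnorm (c *: u + v) <= rho / 8 -> rnorm u <= rho / 8 -> rnorm v <= rho / 8 ->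
  opnorm (F (p + (c *: u + v)) - F p - c *: (F (p + u) - F p) - (F (p + v) - F p)) <=
  144 ^+ 2 * M / rho ^+ 2 *
    (rnorm (c *: u + v) ^+ 2 + rnorm c * rnorm u ^+ 2 + rnorm v ^+ 2).
Proof.
move=> rho0 M0 dF bF h1 h2 h3; apply: (opnorm_le_form hdot).
  by rewrite mulr_ge0 ?addr_ge0 ?mulr_ge0 ?invr_ge0 ?exprn_ge0 ?sqr_ge0 ?rnorm_ge0// ltW.
move=> x y.
have := @second_difference_ball R V (fun q => dot (F q x) y) p rho
  (M * rnorm x * rnorm y) c u v rho0 (dF x y) _ h1 h2 h3.
rewrite !bop_subE bop_scaleE !bop_subE !(hermBl hherm) (hermZl hherm) !(hermBl hherm).
move=> /(_ _)/le_trans; apply.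
  move=> q /bF h; apply: le_trans (form_le hdot _ _ _) _.
  by rewrite !ler_wpM2r ?rnorm_ge0.
by rewrite le_eqVlt; apply/orP; left; apply/eqP; ring.
Qed.

Lemma form_linear x y : linear (fun T : bop H => dot (T x) y : C).
Proof. by move=> c S T; rewrite bop_addE bop_scaleE (hermDl hherm) (hermZl hherm). Qed.

Lemma has_diff_form F p D x y : has_diff F p D ->
  exists D', has_diff (fun q => dot (F q x) y) p D'.
Proof.
move=> hF; exists ((fun T : bop H => dot (T x) y : C) \o D).
apply: (@has_diff_linear _ _ _ _ (rnorm x * rnorm y) _ _ (form_linear x y) _ hF) => T.
by rewrite rnorm_bop mulrC mulrA; exact: (form_le hdot).
Qed.

End OperatorValuedMaps.

(** * Extension *)

Section Extension.
Variables (R : realType) (n : nat).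
Local Notation C := (CC R).
Local Notation Cn := 'rV[CC R]_n.
Variable H : completeNormedModType C.
Implicit Types (x y : H) (z w : Cn).
Variable dot : H -> H -> C.
Hypothesis hdot : inner_product dot.
Let hherm : hermitian_form dot := hdot.1.

Lemma open_contains_ball (Omega : set Cn) z : open Omega -> Omega z ->
  exists2 rho : R, 0 < rho & forall w, rnorm (w - z) < rho -> Omega w.
Proof. by move=> /open_rnormP h /h. Qed.

(* [E] is applied to the scalar functions [z |-> <P (K z x), y>], where [K] is *)
(* the Moebius transform of [f] that vanishes at [a].                          *)
Lemma contraction_extension (Omega V : set Cn) (a : Cn) (E : (Cn -> C) -> Cn -> C)
    (f : Cn -> bop H) (r : R) :
  open Omega -> V `<=` Omega -> V a -> isometric_linear_extension a Omega V E ->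
  holomorphic_on V f -> 0 <= r -> r < 1 -> (forall z, V z -> opnorm (f z) <= r) ->
  exists F : Cn -> bop H, [/\ forall z, Omega z -> exists D, has_diff F z D,
    forall z, V z -> F z = f z & forall z, Omega z -> opnorm (F z) <= 1].
Proof.
move=> oO VO Va [E1 E2 E3 E4 E5] hf r0 r1 fr.
set A := f a; have Ar : opnorm A <= r := fr a Va.
have [As adjA] := adjoint_exists hdot A; have adjA' := adjoint_sym hdot adjA.
have Asr : opnorm As <= r := le_trans (opnorm_adjoint hdot adjA) Ar.
have [P [Pl Pr Psa Plb Pub]] := defect_inverse hdot r0 r1 adjA Ar.
have [Q [Ql Qr Qsa Qlb Qub]] := defect_inverse hdot r0 r1 adjA' Asr.
have r10 : 0 < 1 - r by rewrite subr_gt0.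
have r2 : 0 < 1 - r ^+ 2 by rewrite subr_gt0 expr_lt1.
pose q x := complex.Re (dot (Q x) x); pose p x := complex.Re (dot (P x) x).
have q0 x : 0 <= q x := le_trans (sqr_ge0 _) (Qlb x).
have p0 x : 0 <= p x := le_trans (sqr_ge0 _) (Plb x).
have /boolp.choice[kf hkf] : forall T, exists K : bop H, opnorm T <= 1 ->
   exists S : bop H, [/\ moebius A As T K, forall x, S x - As (T (S x)) = x, opnorm K <= 2 / (1 - r) &
    forall x, complex.Re (dot (P (K x)) (K x)) <= q x].
  move=> T; have [T1|_] := boolP (opnorm T <= 1); last by exists 0.
  have [K [S h]] := moebius_exists hdot adjA r1 Ar Pl Pr Ql Qr T1.
  by exists K => _; exists S.
have f1 z : V z -> opnorm (f z) <= 1 by move=> /fr fz; apply: le_trans fz (ltW r1).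
pose h x y z : C := dot (P (kf (f z) x)) y.
have hle x y z : V z -> rnorm (h x y z) ^+ 2 <= q x * p y.
  move=> /f1 fz; have [S [_ _ _ Kc]] := hkf _ fz.
  apply: le_trans (defect_form_CS hdot Psa Plb _ _) _.
  exact: ler_wpM2r (p0 y) _ _ (Kc x).
have hle' x y z : V z -> rnorm (h x y z) <= Num.sqrt (q x * p y).
  move=> Vz; rewrite -(@ler_pXn2r _ 2)// ?nnegrE ?rnorm_ge0 ?sqrtr_ge0//.
  by rewrite sqr_sqrtr ?mulr_ge0// hle.
have hH x y : Hinfty_at a V (h x y).
  split; last first.
    have [S [mK _ _ _]] := hkf _ (f1 a Va).
    by rewrite /h -[x](Qr x) mK subrr bop0 (herm0l hherm).
  split; last by apply/bounded_rnormP; exists (Num.sqrt (q x * p y)) => z; exact: hle'.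
  move=> z Vz; have [U [G [oU Uz dG Gf]]] := hf z Vz.
  (* Off [V] the local extension [G] may leave the unit ball, where [kf] takes its default value
     0. *)
  pose U' := [set w | U w /\ opnorm (G w) < 1].
  have cG w (e : R) : U w -> 0 < e -> exists2 d : R, 0 < d & forall w', rnorm (w' - w) < d ->
      U w' /\ opnorm (G w') < opnorm (G w) + e.
    move=> Uw e0; have [d1 d10 hd1] := open_contains_ball oU Uw.
    have [d2 d20 hd2] := (continuous_rnormP G w).1 (differentiable_continuous (dG w Uw)) e e0.
    exists (Num.min d1 d2); first by rewrite lt_min d10.
    move=> w'; rewrite lt_min => /andP[/hd1 Uw' /hd2 h2]; split=> //.
    rewrite -!rnorm_bop -ltrBlDl; apply: le_lt_trans h2.
    by rewrite lerBlDr -{1}(subrK (G w) (G w')) rnormD.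
  have oU' : open U'.
    apply/open_rnormP => w [Uw Gw]; have e0 : 0 < 1 - opnorm (G w) by rewrite subr_gt0.
    have [d d0 hd] := cG w _ Uw e0; exists d => // w' /hd[Uw' Gw']; split=> //.
    by rewrite subrKC in Gw'.
  have Gz : G z = f z by apply: Gf; rewrite inE.
  exists U', (fun w => dot (P (kf (G w) x)) y); split=> //.
  - by split=> //; rewrite Gz; apply: le_lt_trans (fr z Vz) r1.
  - move=> w [Uw Gw]; have Gw0 : 0 < 1 - opnorm (G w) by rewrite subr_gt0.
    have [d d0 hd] := cG w _ Uw Gw0.
    have Gb k : rnorm k < d -> opnorm (G (w + k)) <= 1.
      move=> kd; have kd' : rnorm (w + k - w) < d by rewrite addrC addKr.
      by apply: ltW; have [_] := hd _ kd'; rewrite subrKC.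
    have [D hD] := (differentiable_has_diff G w).1 (dG w Uw).
    have [S [mw Sw _ _]] := hkf _ (ltW Gw).
    have Kb T : opnorm T <= 1 -> opnorm (bid + bcomp (kf T) As) <= 1 + 2 / (1 - r) * r.
      move=> /hkf[S' [_ _ Kb _]]; apply: le_trans (opnormD _ _) _.
      apply: lerD; first exact: opnorm_id.
      by apply: le_trans (opnorm_comp _ _) _; rewrite ler_pM ?opnorm_ge0.
    have [D' hD'] : exists D, has_diff (kf \o G) w D.
      apply: (@has_diff_transfer _ _ _ (kf \o G) G (fun w => bid + bcomp (kf (G w)) As)
        As S w _ d D d0 hD) => [k kd v|k kd v|k /Gb/Kb].
      + have [S' [mk _ _ _]] := hkf _ (Gb k kd).
        have := moebius_diff (S v) mk mw; rewrite Sw => ->.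
        by rewrite bop_addE bcompE.
      + by rewrite !bop_addE !bcompE opprD addrACA subrr add0r.
      + exact.
    have [D2 hD2] : exists D, has_diff (fun w => bcomp P (kf (G w))) w D.
      exists (bcomp P \o D').
      apply: (@has_diff_linear _ _ _ _ _ (bcomp P) (opnorm P) _ _ _ _ hD').
        by move=> c S1 S2; apply: bop_ext => v; rewrite bcompE !bop_addE !bop_scaleE bop_linear.
      by move=> T; rewrite !rnorm_bop opnorm_comp.
    have [D3 hD3] := has_diff_form hdot x y hD2.
    by apply/differentiable_has_diff; exists D3.
  - by move=> w; rewrite inE => -[Vw [Uw _]]; rewrite /h Gf// inE.
have Eb x y z : Omega z -> rnorm (E (h x y) z) ^+ 2 <= q x * p y.
  move=> Oz; have [[_ /bounded_rnormP[M hM]] _] := E1 _ (hH x y).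
  have := sup_norm_ub hM Oz; rewrite E5// => h1.
  have := le_trans h1 (sup_norm_le Va (hle' x y)).
  rewrite -(@ler_pXn2r _ 2)// ?nnegrE ?rnorm_ge0 ?sqrtr_ge0//.
  by rewrite sqr_sqrtr ?mulr_ge0.
pose M := (1 - r ^+ 2)^-1; have M0 : 0 <= M by rewrite invr_ge0 ltW.
have qM x : q x <= M * rnorm x ^+ 2 by rewrite ler_pdivlMl//; exact: Qub.
have pM x : p x <= M * rnorm x ^+ 2 by rewrite ler_pdivlMl//; exact: Pub.
have Eb' x y z : Omega z -> rnorm (E (h x y) z) <= M * rnorm x * rnorm y.
  move=> Oz; rewrite -(@ler_pXn2r _ 2)// ?nnegrE ?mulr_ge0 ?rnorm_ge0//.
  apply: le_trans (Eb _ _ _ Oz) _; apply: le_trans (ler_pM (q0 x) (p0 y) (qM x) (pM y)) _.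
  by rewrite le_eqVlt; apply/orP; left; apply/eqP; ring.
have /boolp.choice[G' hG'] : forall z, exists T : bop H, Omega z ->
    (forall x y, dot (T x) y = E (h x y) z) /\ opnorm T <= M.
  move=> z; have [Oz|nOz] := pselect (Omega z); last by exists 0.
  have [||||T hT] := @sesquilinear_operator _ _ dot hdot (fun x y => E (h x y) z) M.
  - exact: M0.
  - move=> c x x' y; have -> : h (c *: x + x') y = c *: h x y + h x' y.
      by apply/funext => w; rewrite /h !bop_linear (hermDl hherm) (hermZl hherm).
    by rewrite E3// inE.
  - move=> c y y' x; have -> : h x (c *: y + y') = c^* *: h x y + h x y'.
      by apply/funext => w; rewrite /h (hermDr hherm) (hermZr hherm).
    by rewrite E3// inE.
  - by move=> x y; exact: Eb'.
  - by exists T.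
(* [G'] represents P G; multiplying by the inverse of [P] recovers G. *)
pose G z := bcomp (bid - bcomp A As) (G' z).
have PG z x : P (G z x) = G' z x by rewrite /G bcompE bop_subE; exact: Pl.
(* With y = G z x the scalar bound reads [t ^+ 2 <= q x * t], and one factor [t] cancels. *)
have Gc z x : Omega z -> complex.Re (dot (P (G z x)) (G z x)) <= q x.
  move=> Oz; rewrite -/(p (G z x)); set t := p _.
  have : t ^+ 2 <= q x * t.
    apply: le_trans (Eb x (G z x) z Oz); have [<- _] := hG' z Oz.
    rewrite /t /p PG -(real_normK (num_real _)) lerXn2r ?nnegrE ?rnorm_ge0//.
    exact: Re_le_rnorm.
  have : 0 <= t by exact: p0.
  rewrite le_eqVlt => /orP[/eqP <- _|t0]; first exact: q0.
  by rewrite expr2 ler_pM2r.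
have dG' z : Omega z -> exists D, has_diff G' z D.
  move=> Oz; have [rho rho0 hrho] := open_contains_ball oO Oz.
  have rho8 : 0 < rho / 8 by rewrite divr_gt0.
  have [U [UU Uoo]] := ultrafilter_nat.
  have in8 u : rnorm u <= rho / 8 -> Omega (z + u).
    by move=> hu; apply: hrho; rewrite addrC addKr; lra.
  apply: (second_difference_has_diff hdot UU Uoo rho8 (k := 144 ^+ 2 * M / rho ^+ 2) (M := M)).
  - by rewrite divr_ge0 ?mulr_ge0 ?exprn_ge0// ltW.
  - by move=> u /in8 /hG'[].
  - move=> c u v h1 h2 h3; apply: (weak_second_difference hdot) => // [x y w /hrho Ow|w /hrho /hG'[]//].
    have [[hE _] _] := E1 _ (hH x y).
    apply/differentiable_has_diff.
    apply: near_eq_differentiable ((holomorphic_onE _ oO).1 hE w Ow).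
    have [d d0 hd] := open_contains_ball oO Ow.
    by apply/near_rnormP; exists d => // w' /hd/hG'[->].
have dG z : Omega z -> exists D, has_diff G z D.
  move=> /dG'[D hD]; exists (bcomp (bid - bcomp A As) \o D).
  apply: (@has_diff_linear _ _ _ _ _ _ (opnorm (bid - bcomp A As)) _ _ _ _ hD).
    by move=> c S1 S2; apply: bop_ext => v; rewrite bcompE [LHS]bop_linear.
  by move=> T; rewrite !rnorm_bop opnorm_comp.
have /boolp.choice[F hF] : forall z, exists T : bop H, Omega z ->
    [/\ moebius A As T (G z), opnorm T <= 1 &
    forall x, P (x + G z (As x)) - T (As (P (x + G z (As x)))) = x].
  move=> z; have [Oz|nOz] := pselect (Omega z); last by exists 0.
  have [T hT] := moebius_inverse hdot adjA r0 r1 Pl Pr Psa Plb Pub Ql Qr (fun x => Gc z x Oz).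
  by exists T.
exists F; split.
- move=> z Oz; have [rho rho0 hrho] := open_contains_ball oO Oz.
  have [mz _ _] := hF z Oz; have [D hD] := dG z Oz.
  have inO k : rnorm k < rho -> Omega (z + k) by move=> ?; apply: hrho; rewrite addrC addKr.
  apply: (@has_diff_transfer _ _ _ F G (fun w => P - bcomp (F w) (bcomp As P))
    (- bcomp As P) (bid - bcomp As (F z)) z (opnorm P + r * opnorm P) rho D rho0 hD)
    => [k /inO/hF[mk _ inv] x|k kd x|k /inO/hF[_ Fb _]].
  + rewrite !bop_subE !bcompE (moebius_diff x mk mz).
    by rewrite inv.
  + rewrite !bop_subE !bcompE !bop_oppE !bcompE !bopN opprK.
    by rewrite opprD addrACA subrr add0r opprK.
  + rewrite -rnorm_bop; apply: le_trans (rnormB _ _) _; rewrite !rnorm_bop lerD2l.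
    apply: le_trans (opnorm_comp _ _) _; rewrite -[leRHS]mul1r.
    apply: ler_pM; rewrite ?opnorm_ge0//; apply: le_trans (opnorm_comp _ _) _.
    by rewrite ler_wpM2r ?opnorm_ge0.
- move=> z Vz; have Oz := VO z Vz; have [mz _ inv] := hF z Oz.
  have [S [mk _ _ _]] := hkf _ (f1 z Vz).
  have GK : G z = kf (f z).
    apply: bop_ext => x; rewrite /G bcompE bop_subE.
    have -> : G' z x = P (kf (f z) x).
      apply: (dot_ext hdot) => y; have [-> _] := hG' z Oz.
      by rewrite E4// inE.
    exact: Pr.
  rewrite -GK in mk; apply: bop_ext => x.
  (* [F z] and [f z] have the same transform, so 1 + G As kills their difference, and its left
     inverse shows that the difference is 0. *)
  have := moebius_diff x mz mk; rewrite subrr => e.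
  have := inv (F z x - f z x); rewrite -e !bop0 subrr => /esym/eqP.
  by rewrite subr_eq0 => /eqP.
- by move=> z /hF[].
Qed.

Lemma isometric_extension_approx (Omega V : set Cn) (a : Cn)
    (E : (Cn -> C) -> Cn -> C) (f : Cn -> bop H) (N N' : R) :
  open Omega -> V `<=` Omega -> V a -> isometric_linear_extension a Omega V E ->
  holomorphic_on V f -> 0 <= N -> N < N' -> (forall z, V z -> opnorm (f z) <= N) ->
  exists F : Cn -> bop H, [/\ forall z, Omega z -> exists D, has_diff F z D,
    forall z, V z -> F z = f z & forall z, Omega z -> opnorm (F z) <= N'].
Proof.
move=> oO VO Va hE hf N0 NN fN; have N'0 : 0 < N' := le_lt_trans N0 NN.
have nZ (c : R) (T : bop H) : 0 <= c -> opnorm ((c%:C%C : C) *: T) = c * opnorm T.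
  by move=> c0; rewrite opnormZ rnormR ger0_norm.
have dZ (c : C) (G : Cn -> bop H) z : differentiable G z ->
    differentiable (fun w => c *: G w) z.
  by move=> dG; exact: differentiableZ.
have [||||F [dF Ff Fb]] := @contraction_extension Omega V a E
  (fun z => ((N'^-1)%:C%C : C) *: f z) (N / N') oO VO Va hE.
- move=> z Vz; have [U [G [oU Uz dG Gf]]] := hf z Vz.
  exists U, (fun w => ((N'^-1)%:C%C : C) *: G w).
  split; [exact: oU|exact: Uz|by move=> w /dG/dZ|by move=> w hw; rewrite Gf].
- by rewrite divr_ge0// ltW.
- by rewrite ltr_pdivrMr// mul1r.
- by move=> z Vz; rewrite nZ ?invr_ge0 ?(ltW N'0)// mulrC ler_pM2r ?invr_gt0// fN.
exists (fun z => (N'%:C%C : C) *: F z); split.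
- move=> z Oz; apply/differentiable_has_diff/dZ/differentiable_has_diff.
  exact: dF.
- by move=> z Vz; rewrite Ff// scalerA -rmorphM mulfV ?gt_eqF// rmorph1 scale1r.
- by move=> z Oz; rewrite nZ ?(ltW N'0)// ger_pMr// Fb.
Qed.

(** The approximate extensions share the bound [N + 1], hence one second-difference estimate, so
    their weak limit is differentiable; large indices bring its norm down to [N]. *)
Lemma isometric_extension (Omega V : set Cn) (a : Cn)
    (E : (Cn -> C) -> Cn -> C) (f : Cn -> bop H) (N : R) :
  open Omega -> V `<=` Omega -> V a -> isometric_linear_extension a Omega V E ->
  holomorphic_on V f -> 0 <= N -> (forall z, V z -> opnorm (f z) <= N) ->
  exists F : Cn -> bop H, [/\ forall z, Omega z -> exists D, has_diff F z D,
    forall z, V z -> F z = f z & forall z, Omega z -> opnorm (F z) <= N].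
Proof.
move=> oO VO Va hE hf N0 fN.
have N1 (k : nat) : N < N + k.+1%:R^-1 by rewrite ltrDl invr_gt0.
have /boolp.choice[Fk hFk] := fun k : nat =>
  isometric_extension_approx oO VO Va hE hf N0 (N1 k) fN.
have [U [UU Uoo]] := ultrafilter_nat.
have UF : ProperFilter U := @ultra_proper _ _ UU.
have FkN1 k z : Omega z -> opnorm (Fk k z) <= N + 1.
  have [_ _ Fb] := hFk k; move=> /Fb/le_trans; apply.
  by rewrite lerD2l invf_le1// ler1n.
have N10 : 0 <= N + 1 by rewrite addr_ge0.
have /boolp.choice[F hF] : forall z, exists L : bop H, Omega z -> wlim dot U (Fk^~ z) L.
  move=> z; have [Oz|nOz] := pselect (Omega z); last by exists 0.
  have [|L [hL _]] := wlim_exists hdot UU (T := Fk^~ z) N10; last by exists L.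
  by apply: filterS (Uoo 0) => k _; exact: FkN1.
exists F; split.
- move=> z Oz; have [rho rho0 hrho] := open_contains_ball oO Oz.
  have rho8 : 0 < rho / 8 by rewrite divr_gt0.
  have in8 u : rnorm u <= rho / 8 -> Omega (z + u).
    by move=> hu; apply: hrho; rewrite addrC addKr; lra.
  have K0 : 0 <= 144 ^+ 2 * (N + 1) / rho ^+ 2.
    by rewrite divr_ge0 ?mulr_ge0 ?exprn_ge0// ltW.
  apply: (second_difference_has_diff hdot UU Uoo rho8 K0 (M := N + 1)).
  + move=> u /in8 Ou; apply: (wlim_le hdot UU N10 (hF _ Ou)).
    by apply: filterS (Uoo 0) => k _; exact: FkN1.
  + move=> c u v h1 h2 h3.
    have hl := wlimB hdot UU (wlimB hdot UU (wlimB hdot UU (hF _ (in8 _ h1)) (hF z Oz))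
      (wlimZ hdot UU c (wlimB hdot UU (hF _ (in8 _ h2)) (hF z Oz))))
      (wlimB hdot UU (hF _ (in8 _ h3)) (hF z Oz)).
    apply: (wlim_le hdot UU _ hl).
      by rewrite mulr_ge0// !addr_ge0 ?mulr_ge0 ?sqr_ge0 ?rnorm_ge0.
    apply: filterS (Uoo 0) => k _; have [dF _ _] := hFk k.
    apply: (weak_second_difference hdot) => // [x y w /hrho/dF[D hD]|w /hrho/FkN1//].
    exact: (has_diff_form hdot x y hD).
- move=> z Vz; have Oz := VO z Vz; apply: bop_ext => x; apply: (dot_ext hdot) => y.
  apply: (ulim_unique UU (hF z Oz x y)).
  have -> : (fun k => dot (Fk k z x) y) = (fun=> dot (f z x) y).
    by apply/funext => k; have [_ Ff _] := hFk k; rewrite Ff.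
  exact: ulim_cst.
- move=> z Oz; apply/ler_addgt0Pl => e e0; rewrite addrC.
  apply: (wlim_le hdot UU _ (hF z Oz)); first by rewrite addr_ge0// ltW.
  apply: filterS (Uoo (Num.bound e^-1)) => k /= hk; have [_ _ Fb] := hFk k.
  apply: le_trans (Fb z Oz) _; rewrite lerD2l -[leRHS]invrK lef_pV2 ?posrE ?invr_gt0//.
  apply: le_trans (ltW (archi_boundP _)) _; first by rewrite invr_ge0 ltW.
  by rewrite ler_nat; exact: leqW.
Qed.

End Extension.

Theorem proposition3p7 (R : realType) (n : nat) (Omega V : set 'rV[CC R]_n)
    (a : 'rV[CC R]_n) :
  cartan_pair Omega V -> connected V -> V a ->
  (exists E : ('rV[CC R]_n -> CC R) -> ('rV[CC R]_n -> CC R),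
     isometric_linear_extension a Omega V E) ->
  complete_np_pair Omega V.
Proof.
move=> [_ [oO _] [VO _]] _ Va [E hE] H /hilbert_inner_product[dot hdot] _ f [hf bf].
have /bounded_rnormP[M hM] := bf.
have fN z : V z -> opnorm (f z) <= sup_norm V f.
  by move=> Vz; rewrite -rnorm_bop; exact: sup_norm_ub hM Vz.
have N0 : 0 <= sup_norm V f := le_trans (opnorm_ge0 _) (fN a Va).
have [F [dF Ff Fb]] := isometric_extension hdot oO VO Va hE hf N0 fN.
have Fb' z : Omega z -> rnorm (F z) <= sup_norm V f by rewrite rnorm_bop; exact: Fb.
exists F; split.
- split; last by apply/bounded_rnormP; exists (sup_norm V f).
  apply/(holomorphic_onE _ oO) => z Oz; apply/differentiable_has_diff.
  exact: dF.
- by move=> z; rewrite inE; exact: Ff.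
- apply/eqP; rewrite eq_le (sup_norm_le (VO a Va) Fb') /=.
  apply: (sup_norm_le Va) => z Vz; rewrite -Ff//.
  exact: sup_norm_ub Fb' (VO z Vz).
Qed.
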